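(* Let $S\subset\mathbb{R}^n$ be a semialgebraic set satisfying the arc-analytic extension property. Then $S$ has the zero-set property; that is, for any $S$-$\mathcal{AR}$-closed set $X\subset S$ there is a function $f\in{}^{a}\mathcal{A}(S)$ such that $f^{-1}(0)=X$.
   Context: For a semialgebraic set $S\subset\mathbb{R}^n$, an analytic arc $\gamma:(-1,1)\to S$ is a map into $S$ that is real analytic as a map into $\mathbb{R}^n$. A function $f:S\to\mathbb{R}$ is semialgebraic if its graph is semialgebraic, and arc-analytic if $f\circ\gamma$ is real analytic for every analytic arc $\gamma:(-1,1)\to S$. ${}^{a}\mathcal{A}(S)$ is the $\mathbb{R}$-algebra of all semialgebraic arc-analytic functions $S\to\mathbb{R}$. A semialgebraic subset $E\subset S$ is $S$-$\mathcal{AR}$-closed if it is arc-symmetric in $S$: for every analytic arc $\gamma:(-1,1)\to S$, $\gamma((-1,0))\subset E$ implies $\gamma((-1,1))\subset E$. $S$ has the arc-analytic extension property (AEP) if for every $S$-$\mathcal{AR}$-closed set $E\subset S$ and every $f\in{}^{a}\mathcal{A}(E)$ there exists $F\in{}^{a}\mathcal{A}(S)$ such that $F|_E=f$. *)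

(* Defs.v *)
From HB Require Import structures.
From mathcomp Require Import all_boot all_order all_algebra.
From mathcomp Require Import -(notations) mpoly.
From mathcomp Require Import all_classical all_reals all_analysis.

Set Implicit Arguments.
Unset Strict Implicit.
Unset Printing Implicit Defensive.

Import Order.TTheory GRing.Theory Num.Theory.
Import numFieldNormedType.Exports.

Local Open Scope classical_set_scope.
Local Open Scope ring_scope.

(* The notations of [mpoly] clash with those of MathComp-Analysis, hence the
   restricted import.  [mpoly.mpoly n R] is the type {mpoly R[n]}. *)

Definition peval (R : realType) (n : nat) (x : 'rV[R]_n)
    (p : mpoly.mpoly n R) : R :=
  mpoly.meval (fun i => x ord0 i) p.

Definition basic_semialgebraic (R : realType) (n : nat)
    (P Q : seq (mpoly.mpoly n R)) : set 'rV[R]_n :=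
  [set x | (forall p, p \in P -> peval x p = 0) /\
           (forall q, q \in Q -> 0 < peval x q)].

Definition semialgebraic (R : realType) (n : nat) (A : set 'rV[R]_n) : Prop :=
  exists s : seq (seq (mpoly.mpoly n R) * seq (mpoly.mpoly n R)),
    A = [set x | exists2 PQ, PQ \in s & basic_semialgebraic PQ.1 PQ.2 x].

Definition real_analytic_at (R : realType) (g : R -> R) (t0 : R) : Prop :=
  exists a : R^nat, \forall t \near t0, pseries a (t - t0) @ \oo --> g t.

Definition real_analytic_on (R : realType) (D : set R) (g : R -> R) : Prop :=
  forall t, D t -> real_analytic_at g t.

(* Arcs are total functions on R of which only the restriction to (-1, 1)
   matters; likewise a function on S is a total function on R^n of which only
   the restriction to S matters. *)
Definition analytic_arc (R : realType) (n : nat) (S : set 'rV[R]_n)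
    (gamma : R -> 'rV[R]_n) : Prop :=
  (forall t : R, `]-1, 1[%classic t -> S (gamma t)) /\
  (forall i : 'I_n, real_analytic_on `]-1, 1[ (fun t => gamma t ord0 i)).

Definition graph_on (R : realType) (n : nat) (S : set 'rV[R]_n)
    (f : 'rV[R]_n -> R) : set 'rV[R]_(n + 1) :=
  [set row_mx x (f x)%:M | x in S].

Definition semialgebraic_fun (R : realType) (n : nat) (S : set 'rV[R]_n)
    (f : 'rV[R]_n -> R) : Prop :=
  semialgebraic (graph_on S f).

Definition arc_analytic (R : realType) (n : nat) (S : set 'rV[R]_n)
    (f : 'rV[R]_n -> R) : Prop :=
  forall gamma, analytic_arc S gamma -> real_analytic_on `]-1, 1[ (f \o gamma).

Definition aA (R : realType) (n : nat) (S : set 'rV[R]_n) :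
    set ('rV[R]_n -> R) :=
  [set f | semialgebraic_fun S f /\ arc_analytic S f].

Definition arc_symmetric_in (R : realType) (n : nat) (S E : set 'rV[R]_n) :
    Prop :=
  forall gamma, analytic_arc S gamma ->
    gamma @` `]-1, 0[ `<=` E -> gamma @` `]-1, 1[ `<=` E.

Definition AR_closed (R : realType) (n : nat) (S E : set 'rV[R]_n) : Prop :=
  [/\ semialgebraic E, E `<=` S & arc_symmetric_in S E].

Definition AEP (R : realType) (n : nat) (S : set 'rV[R]_n) : Prop :=
  forall E, AR_closed S E ->
  forall f, aA E f -> exists2 F, aA S F & forall x, E x -> F x = f x.

Definition zero_set_property (R : realType) (n : nat) (S : set 'rV[R]_n) :
    Prop :=
  forall X, AR_closed S X ->
  exists2 f, aA S f & S `&` f @^-1` [set 0] = X.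

(* Main.v *)
Require Import Defs.
From mathcomp Require Import all_boot all_order all_algebra.
From mathcomp Require Import -(notations) mpoly.
From mathcomp Require Import all_classical all_reals all_analysis.
From mathcomp.real_closed Require qe_rcf ordered_qelim.
From mathcomp Require Import polyrcf.
From mathcomp Require Import ring lra.

Set Implicit Arguments.
Unset Strict Implicit.
Unset Printing Implicit Defensive.

Import Order.TTheory GRing.Theory Num.Theory.
Import numFieldNormedType.Exports.

Local Open Scope classical_set_scope.
Local Open Scope ring_scope.

(** The zero sets of the functions in aA(S) satisfy the descending chain
condition, and this forces the smallest zero set [Z] containing [X] to be [X].
If some [y] in [Z] were outside [X], then [X] with [y] adjoined would still be
arc-symmetric in [S], and the function equal to 0 on [X] and to 1 at [y] would
be semialgebraic and arc-analytic on it ([AR_closed_adjoin],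
[indicator_adjoin]): an arc avoids [y] except at isolated times or is constant,
and an arc lying in [X] just before some time lies in [X] at that time.  Its
extension [G] to [S], together with an [F] whose zero set is [Z], gives
[F^2 + G^2], which vanishes on [X] and has a zero set strictly smaller than [Z].

The chain condition ([semialgebraic_noetherian]) holds for all semialgebraic
subsets arc-symmetric in [S].  It passes to finite unions and to images under
maps that are semialgebraic and send analytic arcs to analytic arcs, since
preimages of arc-symmetric sets under such maps are arc-symmetric.  Every
semialgebraic set is a finite union of such images of open cubes (0, 1)^d
([cube_covered], after [stretch] has brought the set into a cube), so only
cubes matter.  In a cube, an arc-symmetric set that is not the whole cube
contains no nonempty open piece, because the segments leaving such a piece are
analytic arcs and sweep out the cube; so it lies in the zero set of a nonzero
polynomial ([arc_symmetric_hypersurface]) and is covered by cubes of smaller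
dimension.  Induction on the dimension concludes.

The covering by cubes is a cylindrical decomposition.  Over a base on which a
polynomial [q x] in one variable has exactly [k] simple roots, its [i]-th
simple root depends on [x] in an arc-analytic way; if the family of polynomials
is closed under derivation, every root of a nonzero member is a simple root of
some member, and the graphs of these root functions and the bands between them
make up the set ([cells_covered]).  The bases are semialgebraic by quantifier elimination
([sa_ex]).  Since only analyticity along arcs is asked for, the implicit
function theorem is needed for a one-dimensional analytic parameter only
([simple_root_analytic]); it is proved by solving the equation by a power
series and bounding the weighted norms of its truncations. *)

(** * Semialgebraic predicates on types with coordinates *)

(** Formulas are written as predicates on a type of contexts, built from R^n
and R by products; quantifying over a variable is passing from [T * R] to [T],
so that no variable ever has to be numbered. *)
Class Coords (R : realType) (T : Type) := coords : seq (T -> R).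
Arguments coords R T {_}.

#[global] Instance coordsR (R : realType) : Coords R R := [:: id].
#[global] Instance coords_rV (R : realType) n : Coords R 'rV[R]_n :=
  [seq (fun x : 'rV[R]_n => x ord0 i) | i <- enum 'I_n].
#[global] Instance coords_prod (R : realType) T U (c : Coords R T)
    (d : Coords R U) : Coords R (T * U) :=
  [seq g \o fst | g <- coords R T] ++ [seq g \o snd | g <- coords R U].

Section Semialgebra.
Variable R : realType.

Lemma coords_prodE T U (c : Coords R T) (d : Coords R U) :
  coords R (T * U) =
  [seq g \o fst | g <- coords R T] ++ [seq g \o snd | g <- coords R U].
Proof. by []. Qed.

Lemma coords_rVE n :
  coords R 'rV[R]_n = [seq (fun x : 'rV[R]_n => x ord0 i) | i <- enum 'I_n].
Proof. by []. Qed.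

Lemma size_coords_rV n : size (coords R 'rV[R]_n) = n.
Proof. by rewrite coords_rVE size_map size_enum_ord. Qed.

(** The coordinate functions are indexed by all of [nat], with value 0 beyond
the last one, as variables are in environments of formulas. *)
Inductive polyfun (T : Type) (c : Coords R T) : (T -> R) -> Prop :=
| polyfun_cst a : polyfun c (fun=> a)
| polyfun_coord i : polyfun c (nth (fun=> 0) (coords R T) i)
| polyfun_add f g : polyfun c f -> polyfun c g -> polyfun c (fun t => f t + g t)
| polyfun_mul f g : polyfun c f -> polyfun c g -> polyfun c (fun t => f t * g t).

Inductive sa (T : Type) (c : Coords R T) : (T -> Prop) -> Prop :=
| sa_gt0 f : polyfun c f -> sa c (fun t => 0 < f t)
| sa_not P : sa c P -> sa c (fun t => ~ P t)
| sa_and P Q : sa c P -> sa c Q -> sa c (fun t => P t /\ Q t).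

Arguments polyfun {T c}.
Arguments sa {T c}.

Lemma polyfun_ext T (c : Coords R T) (f g : T -> R) :
  f =1 g -> polyfun f -> polyfun g.
Proof. by move=> /funext ->. Qed.

Lemma sa_ext T (c : Coords R T) (P Q : T -> Prop) :
  (forall t, P t <-> Q t) -> sa P -> sa Q.
Proof. by move=> PQ; suff -> : P = Q by []; apply/funext => t; apply/propext. Qed.

Lemma polyfun_opp T (c : Coords R T) (f : T -> R) :
  polyfun f -> polyfun (fun t => - f t).
Proof.
move=> pf; apply: (@polyfun_ext _ _ (fun t => -1 * f t)); first by move=> t; rewrite mulN1r.
by apply: polyfun_mul => //; exact: polyfun_cst.
Qed.

Lemma polyfun_sub T (c : Coords R T) (f g : T -> R) :
  polyfun f -> polyfun g -> polyfun (fun t => f t - g t).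
Proof. by move=> pf pg; apply: polyfun_add => //; exact: polyfun_opp. Qed.

Lemma polyfun_exp T (c : Coords R T) (f : T -> R) n :
  polyfun f -> polyfun (fun t => f t ^+ n).
Proof.
move=> pf; elim: n => [|n IH]; first exact: (polyfun_cst _ 1).
by under eq_fun do rewrite exprS; exact: polyfun_mul.
Qed.

Lemma polyfun_sum T (c : Coords R T) I (r : seq I) (f : I -> T -> R) :
  (forall i, polyfun (f i)) -> polyfun (fun t => \sum_(i <- r) f i t).
Proof.
move=> pf; elim: r => [|i r IH].
  by under eq_fun do rewrite big_nil; exact: polyfun_cst.
by under eq_fun do rewrite big_cons; exact: polyfun_add.
Qed.

Lemma polyfun_prod T (c : Coords R T) I (r : seq I) (f : I -> T -> R) :
  (forall i, polyfun (f i)) -> polyfun (fun t => \prod_(i <- r) f i t).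
Proof.
move=> pf; elim: r => [|i r IH].
  by under eq_fun do rewrite big_nil; exact: polyfun_cst.
by under eq_fun do rewrite big_cons; exact: polyfun_mul.
Qed.

Lemma sa_or T (c : Coords R T) (P Q : T -> Prop) :
  sa P -> sa Q -> sa (fun t => P t \/ Q t).
Proof.
move=> sP sQ; apply: (@sa_ext _ _ (fun t => ~ (~ P t /\ ~ Q t))).
  by move=> t; split=> [/not_andP[]/contrapT|[? []|? []]]; [left|right| |].
by apply/sa_not/sa_and; exact: sa_not.
Qed.

Lemma sa_imp T (c : Coords R T) (P Q : T -> Prop) :
  sa P -> sa Q -> sa (fun t => P t -> Q t).
Proof.
move=> sP sQ; apply: (@sa_ext _ _ (fun t => ~ (P t /\ ~ Q t))).
  by move=> t; split=> [H p|H [/H]//]; apply: contrapT => nq; exact: H.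
by apply/sa_not/sa_and => //; exact: sa_not.
Qed.

Lemma sa_true T (c : Coords R T) : sa (fun=> True).
Proof.
apply: (@sa_ext _ _ (fun=> 0 < 1)); first by move=> t; split.
exact: sa_gt0 (polyfun_cst _ _).
Qed.

Lemma sa_false T (c : Coords R T) : sa (fun=> False).
Proof. by apply: sa_ext (sa_not (sa_true c)) => t; tauto. Qed.

Lemma sa_lt T (c : Coords R T) (f g : T -> R) :
  polyfun f -> polyfun g -> sa (fun t => f t < g t).
Proof.
move=> pf pg; apply: (@sa_ext _ _ (fun t => 0 < g t - f t)).
  by move=> t; rewrite subr_gt0.
exact/sa_gt0/polyfun_sub.
Qed.

Lemma sa_eq T (c : Coords R T) (f g : T -> R) :
  polyfun f -> polyfun g -> sa (fun t => f t = g t).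
Proof.
move=> pf pg; apply: (@sa_ext _ _ (fun t => ~ (f t < g t) /\ ~ (g t < f t))).
  move=> t; split=> [[/negP + /negP]|->]; last by rewrite ltxx.
  by rewrite -!leNgt => ? ?; apply/eqP; rewrite eq_le; apply/andP.
by apply: sa_and; apply/sa_not/sa_lt.
Qed.

Lemma sa_all_seq T (c : Coords R T) (I : eqType) (r : seq I) (P : I -> T -> Prop) :
  (forall i, i \in r -> sa (P i)) -> sa (fun t => forall i, i \in r -> P i t).
Proof.
elim: r => [|i r IH] sP; first by apply: sa_ext (sa_true c) => t; split.
apply: (@sa_ext _ _ (fun t => P i t /\ forall j, j \in r -> P j t)).
  move=> t; split=> [[Pi Pr] j|H]; first by rewrite inE => /predU1P[->//|/Pr].
  by split=> [|j jr]; apply: H; rewrite inE ?eqxx ?jr ?orbT.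
apply: sa_and; first by apply: sP; rewrite inE eqxx.
by apply: IH => j jr; apply: sP; rewrite inE jr orbT.
Qed.

Lemma sa_all_fin T (c : Coords R T) (I : finType) (P : I -> T -> Prop) :
  (forall i, sa (P i)) -> sa (fun t => forall i, P i t).
Proof.
move=> sP; apply: (@sa_ext _ _ (fun t => forall i, i \in enum I -> P i t)).
  by move=> t; split=> H i => [|_]; apply: H; rewrite ?mem_enum.
by apply: sa_all_seq => i _.
Qed.

Lemma sa_ex_seq T (c : Coords R T) (I : eqType) (r : seq I) (P : I -> T -> Prop) :
  (forall i, i \in r -> sa (P i)) -> sa (fun t => exists2 i, i \in r & P i t).
Proof.
move=> sP; apply: (@sa_ext _ _ (fun t => ~ forall i, i \in r -> ~ P i t)).
  move=> t; split=> [|[i ir Pi] H]; last exact: H Pi.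
  by move=> /existsNP[i /not_implyP[ir /contrapT Pi]]; exists i.
by apply/sa_not/sa_all_seq => i ir; exact/sa_not/sP.
Qed.

Lemma sa_ex_fin T (c : Coords R T) (I : finType) (P : I -> T -> Prop) :
  (forall i, sa (P i)) -> sa (fun t => exists i, P i t).
Proof.
move=> sP; apply: (@sa_ext _ _ (fun t => exists2 i, i \in enum I & P i t)).
  by move=> t; split=> [[i _]|[i]] Pi; exists i; rewrite ?mem_enum.
by apply: sa_ex_seq => i _.
Qed.

(** Substitution: maps that pull polynomial functions back to polynomial
functions pull semialgebraic predicates back to semialgebraic predicates. *)
Definition polymap T U (c : Coords R T) (d : Coords R U) (h : T -> U) :=
  forall f : U -> R, polyfun f -> polyfun (f \o h).
Arguments polymap {T U c d}.

Lemma polymapP T U (c : Coords R T) (d : Coords R U) (h : T -> U) :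
  (forall i, polyfun (nth (fun=> 0) (coords R U) i \o h)) -> polymap h.
Proof.
move=> ph f; elim=> {f} [a|i|f g _ IHf _ IHg|f g _ IHf _ IHg] //.
- exact: polyfun_cst.
- exact: polyfun_add.
- exact: polyfun_mul.
Qed.

Lemma polymap_id T (c : Coords R T) : polymap (@id T).
Proof. by []. Qed.

Lemma polymap_comp T U V (c : Coords R T) (d : Coords R U) (e : Coords R V)
  (h : T -> U) (k : U -> V) : polymap h -> polymap k -> polymap (fun t => k (h t)).
Proof. by move=> ph pk f /pk /ph. Qed.

Lemma polymap_fst T U (c : Coords R T) (d : Coords R U) : polymap (@fst T U).
Proof.
apply: polymapP => i; have [Hi|Hi] := ltnP i (size (coords R T)); last first.
  by rewrite nth_default //; exact: polyfun_cst.
have := polyfun_coord (coords_prod c d) i.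
by rewrite coords_prodE nth_cat size_map Hi (nth_map (fun=> 0)).
Qed.

Lemma polymap_snd T U (c : Coords R T) (d : Coords R U) : polymap (@snd T U).
Proof.
apply: polymapP => i; have [Hi|Hi] := ltnP i (size (coords R U)); last first.
  by rewrite nth_default //; exact: polyfun_cst.
have := polyfun_coord (coords_prod c d) (size (@coords R T c) + i).
by rewrite coords_prodE nth_cat size_map ltnNge leq_addr /= addKn (nth_map (fun=> 0)).
Qed.

Lemma polymap_pair T U V (c : Coords R T) (d : Coords R U) (e : Coords R V)
  (h : T -> U) (k : T -> V) :
  polymap h -> polymap k -> polymap (fun t => (h t, k t)).
Proof.
move=> ph pk; apply: polymapP => i; rewrite coords_prodE nth_cat !size_map.
case: ltnP => Hi.
  by rewrite (nth_map (fun=> 0)) //; apply: ph; exact: polyfun_coord.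
have [Hi2|Hi2] := ltnP (i - size (coords R U)) (size (coords R V)).
  by rewrite (nth_map (fun=> 0)) //; apply: pk; exact: polyfun_coord.
by rewrite nth_default ?size_map //; exact: polyfun_cst.
Qed.

Lemma polymap_fun T (c : Coords R T) (h : T -> R) : polyfun h -> polymap h.
Proof.
move=> ph; apply: polymapP => -[|i] //=.
by rewrite nth_nil; exact: polyfun_cst.
Qed.

Lemma polyfun_id : polyfun (@id R).
Proof. exact: (polyfun_coord (coordsR R) 0). Qed.

Lemma polyfun_of_map T (c : Coords R T) (h : T -> R) : polymap h -> polyfun h.
Proof. by move=> /(_ _ polyfun_id). Qed.

Lemma polyfun_entry n (i : 'I_n) : polyfun (fun x : 'rV[R]_n => x ord0 i).
Proof.
have := polyfun_coord (coords_rV R n) i.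
by rewrite coords_rVE (nth_map i) ?nth_ord_enum // size_enum_ord.
Qed.

Lemma polymap_rV T (c : Coords R T) n (h : T -> 'rV[R]_n) :
  (forall i, polyfun (fun t => h t ord0 i)) -> polymap h.
Proof.
move=> ph; apply: polymapP => i; have [Hi|Hi] := ltnP i n; last first.
  by rewrite nth_default ?size_coords_rV //; exact: polyfun_cst.
rewrite coords_rVE (nth_map (Ordinal Hi)) ?size_enum_ord //; exact: ph.
Qed.

Lemma polymap_entry T (c : Coords R T) n (h : T -> 'rV[R]_n) i :
  polymap h -> polyfun (fun t => h t ord0 i).
Proof. by move=> /(_ _ (polyfun_entry i)). Qed.

Lemma polymap_row_mx T (c : Coords R T) m n (h : T -> 'rV[R]_m) (k : T -> 'rV[R]_n) :
  polymap h -> polymap k -> polymap (fun t => row_mx (h t) (k t)).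
Proof.
move=> ph pk; apply: polymap_rV => i; case: (split_ordP i) => j ->.
  by under eq_fun do rewrite row_mxEl; exact: polymap_entry.
by under eq_fun do rewrite row_mxEr; exact: polymap_entry.
Qed.

Lemma polymap_scalar T (c : Coords R T) (h : T -> R) :
  polyfun h -> polymap (fun t => (h t)%:M : 'rV[R]_1).
Proof.
move=> ph; apply: polymap_rV => i; apply: polyfun_ext ph => t.
by rewrite (ord1 i) mxE eqxx mulr1n.
Qed.

Lemma polymap_lsub T (c : Coords R T) m n (h : T -> 'rV[R]_(m + n)) :
  polymap h -> polymap (fun t => lsubmx (h t)).
Proof.
by move=> ph; apply: polymap_rV => i; under eq_fun do rewrite mxE;
  exact: polymap_entry.
Qed.

Lemma polymap_rsub T (c : Coords R T) m n (h : T -> 'rV[R]_(m + n)) :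
  polymap h -> polymap (fun t => rsubmx (h t)).
Proof.
by move=> ph; apply: polymap_rV => i; under eq_fun do rewrite mxE;
  exact: polymap_entry.
Qed.

Lemma sa_subst T U (c : Coords R T) (d : Coords R U) (P : U -> Prop) (h : T -> U) :
  sa P -> polymap h -> sa (fun t => P (h t)).
Proof.
move=> sP ph; elim: sP => {P} [f pf|P _ IH|P Q _ IHP _ IHQ].
- by apply: sa_gt0; exact: (ph _ pf).
- exact: sa_not.
- exact: sa_and.
Qed.

Definition env T (c : Coords R T) (t : T) : seq R := [seq g t | g <- coords R T].
Arguments env {T c}.

Lemma nth_env T (c : Coords R T) t i :
  (env t)`_i = nth (fun=> 0) (coords R T) i t.
Proof.
have [Hi|Hi] := ltnP i (size (coords R T)); first by rewrite (nth_map (fun=> 0)).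
by rewrite !nth_default ?size_map.
Qed.

Lemma polyfun_term T (c : Coords R T) f : polyfun f ->
  exists u : GRing.term R, forall t, GRing.eval (env t) u = f t.
Proof.
elim=> {f} [a|i|f g _ [u hu] _ [v hv]|f g _ [u hu] _ [v hv]].
- by exists (GRing.Const a).
- by exists (GRing.Var _ i) => t; rewrite /= nth_env.
- by exists (GRing.Add u v) => t /=; rewrite hu hv.
- by exists (GRing.Mul u v) => t /=; rewrite hu hv.
Qed.

Lemma term_polyfun T (c : Coords R T) (u : GRing.term R) : GRing.rterm u ->
  polyfun (fun t : T => GRing.eval (env t) u).
Proof.
elim: u => //=.
- by move=> i _; under eq_fun do rewrite nth_env; exact: polyfun_coord.
- by move=> a _; exact: polyfun_cst.
- by move=> n _; exact: polyfun_cst.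
- by move=> u IHu v IHv /andP[/IHu pu /IHv]; exact: polyfun_add.
- by move=> u IHu /IHu; exact: polyfun_opp.
- move=> u IHu n /IHu pu; under eq_fun do rewrite -mulr_natr.
  by apply: polyfun_mul => //; exact: polyfun_cst.
- by move=> u IHu v IHv /andP[/IHu pu /IHv]; exact: polyfun_mul.
- by move=> u IHu n /IHu; exact: polyfun_exp.
Qed.

Lemma sa_formula T (c : Coords R T) P : sa P ->
  exists f : ordered_qelim.ord.formula R,
    forall t, ordered_qelim.ord.holds (env t) f <-> P t.
Proof.
elim=> {P} [f /polyfun_term[u hu]|P _ [f hf]|P Q _ [f hf] _ [g hg]].
- exists (ordered_qelim.ord.Lt (GRing.NatConst _ 0) u) => t /=.
  by rewrite hu.
- by exists (ordered_qelim.ord.Not f) => t /=; rewrite hf.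
- by exists (ordered_qelim.ord.And f g) => t /=; rewrite hf hg.
Qed.

Lemma formula_sa T (c : Coords R T) (f : ordered_qelim.ord.formula R) :
  ordered_qelim.ord.qf_form f -> ordered_qelim.ord.rformula f ->
  sa (fun t : T => ordered_qelim.ord.qf_eval (env t) f).
Proof.
elim: f => //=.
- by case=> _ _; [apply: sa_ext (sa_true c)|apply: sa_ext (sa_false c)].
- move=> u v _ /andP[/term_polyfun pu /term_polyfun pv].
  by apply: sa_ext (sa_eq pu pv) => t; apply: rwP; exact: eqP.
- by move=> u v _ /andP[pu pv]; apply: sa_lt; exact: term_polyfun.
- move=> u v _ /andP[/term_polyfun pu /term_polyfun pv].
  apply: sa_ext (sa_not (sa_lt pv pu)) => t; rewrite leNgt.
  by apply: rwP; exact: negP.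
- move=> f IHf g IHg /andP[/IHf {}IHf /IHg {}IHg] /andP[/IHf sf /IHg sg].
  by apply: sa_ext (sa_and sf sg) => t; apply: rwP; exact: andP.
- move=> f IHf g IHg /andP[/IHf {}IHf /IHg {}IHg] /andP[/IHf sf /IHg sg].
  by apply: sa_ext (sa_or sf sg) => t; apply: rwP; exact: orP.
- move=> f IHf g IHg /andP[/IHf {}IHf /IHg {}IHg] /andP[/IHf sf /IHg sg].
  by apply: sa_ext (sa_imp sf sg) => t; apply: rwP; exact: implyP.
- move=> f IHf /IHf {}IHf /IHf sf.
  by apply: sa_ext (sa_not sf) => t; apply: rwP; exact: negP.
Qed.

(** The projection theorem of Tarski and Seidenberg.  The variable to be
eliminated comes last in the product, so that adding its value to an
environment is setting the entry just after the end. *)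
Lemma sa_ex T (c : Coords R T) (P : T -> R -> Prop) :
  sa (fun p : T * R => P p.1 p.2) -> sa (fun t => exists y, P t y).
Proof.
move=> /sa_formula[f hf].
pose g := ordered_qelim.ord.Exists (size (@coords R T c)) f.
have gP t : ordered_qelim.ord.holds (@env T c t) g <-> exists y, P t y.
  have e y : set_nth 0 (@env T c t) (size (@coords R T c)) y =
      @env (T * R)%type (coords_prod c (coordsR R)) (t, y).
    rewrite /env coords_prodE map_cat -map_comp /=.
    apply: (@eq_from_nth _ 0).
      by rewrite size_set_nth size_cat !size_map /= addn1 (maxn_idPl (leqnSn _)).
    move=> i _; rewrite nth_set_nth /= nth_cat size_map.
    case: ltngtP => // [Hi|->]; last by rewrite subnn.
    by rewrite nth_default ?size_map ?(ltnW Hi) // nth_default //= subn_gt0.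
  by split=> -[y]; [move=> H|move=> /(hf (t, y))]; exists y; 
    [apply/(hf (t, y)); rewrite -e|rewrite e].
apply: (@sa_ext _ _ (fun t => qe_rcf.rcf_sat (@env T c t) g)).
  by move=> t; rewrite -gP -(rwP (qe_rcf.rcf_satP _ _)).
rewrite /qe_rcf.rcf_sat /ordered_qelim.ord.proj_sat.
have /andP[] := ordered_qelim.ord.quantifier_elim_wf (@qe_rcf.wf_QE_wproj R)
  (ordered_qelim.ord.to_rform_rformula g).
exact: formula_sa.
Qed.

Lemma sa_all T (c : Coords R T) (P : T -> R -> Prop) :
  sa (fun p : T * R => P p.1 p.2) -> sa (fun t => forall y, P t y).
Proof.
move=> sP; apply: (@sa_ext _ _ (fun t => ~ exists y, ~ P t y)).
  move=> t; split=> [H y|H [y]]; last exact.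
  by apply: contrapT => nP; apply: H; exists y.
exact/sa_not/sa_ex/sa_not.
Qed.

Lemma sa_ex_rV n T (c : Coords R T) (P : T -> 'rV[R]_n -> Prop) :
  sa (fun p : T * 'rV[R]_n => P p.1 p.2) -> sa (fun t => exists v, P t v).
Proof.
elim: n T c P => [|n IH] T c P sP.
  apply: (@sa_ext _ _ (fun t => P t 0)).
    by move=> t; split=> [|[v]]; [exists 0|rewrite (_ : v = 0) //; apply/rowP; case].
  apply: (sa_subst (h := fun t => (t, 0))) sP _.
  apply: polymap_pair; first exact: polymap_id.
  by apply: polymap_rV => i; under eq_fun do rewrite mxE; exact: polyfun_cst.
apply: (@sa_ext _ _ (fun t => exists y, exists v : 'rV[R]_n,
    P t (row_mx (y%:M : 'rV_1) v : 'rV_(1 + n)))).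
  move=> t; split=> [[y [v Pv]]|[v Pv]]; first by eexists; exact: Pv.
  exists (lsubmx (v : 'rV_(1 + n)) ord0 ord0), (rsubmx (v : 'rV_(1 + n))).
  by rewrite -mx11_scalar hsubmxK.
apply/sa_ex/IH.
apply: (sa_subst (h := fun q => (q.1.1, row_mx (q.1.2%:M : 'rV_1) q.2 : 'rV_(1 + n)))) sP _.
have p1 := @polymap_fst _ _ (coords_prod c (coordsR R)) (coords_rV R n).
apply: polymap_pair; first exact: polymap_comp p1 (@polymap_fst _ _ _ _).
apply: polymap_row_mx; last exact: polymap_snd.
apply/polymap_scalar/polyfun_of_map; exact: polymap_comp p1 (@polymap_snd _ _ _ _).
Qed.

Lemma polyfun_peval n (p : mpoly n R) : polyfun (fun x : 'rV[R]_n => peval x p).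
Proof.
elim/(@mpolyind n R): p => [|a m p _ _ IH].
  by under eq_fun do rewrite /peval meval0; exact: polyfun_cst.
under eq_fun do rewrite /peval mevalD mevalZ mevalX.
apply: polyfun_add => //; apply: polyfun_mul; first exact: polyfun_cst.
by apply: polyfun_prod => i; apply/polyfun_exp/polyfun_entry.
Qed.

Lemma polyfunP n (f : 'rV[R]_n -> R) : polyfun f ->
  exists p : mpoly n R, forall x, f x = peval x p.
Proof.
rewrite /peval; elim=> {f} [a|i|f g _ [u hu] _ [v hv]|f g _ [u hu] _ [v hv]].
- by exists (mpolyC n a) => x; rewrite mevalC.
- have [Hi|Hi] := ltnP i n; last first.
    by exists (mpolyC n 0) => x; rewrite mevalC nth_default // size_coords_rV.
  exists (mpolyX R (mnm1 (Ordinal Hi))) => x.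
  by rewrite coords_rVE (nth_map (Ordinal Hi)) ?size_enum_ord // mevalXU
     (nth_ord_enum (Ordinal Hi) (Ordinal Hi)).
- by exists (u + v) => x; rewrite mevalD hu hv.
- by exists (u * v) => x; rewrite mevalM hu hv.
Qed.

Lemma semialgebraic_setU n (A B : set 'rV[R]_n) :
  semialgebraic A -> semialgebraic B -> semialgebraic (A `|` B).
Proof.
move=> [s ->] [r ->]; exists (s ++ r); apply/seteqP; split=> x /=.
  by case=> -[PQ PQs ?]; exists PQ => //; rewrite mem_cat PQs ?orbT.
by case=> PQ; rewrite mem_cat => /orP[] ? ?; [left|right]; exists PQ.
Qed.

Lemma semialgebraic_setI n (A B : set 'rV[R]_n) :
  semialgebraic A -> semialgebraic B -> semialgebraic (A `&` B).
Proof.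
move=> [s ->] [r ->].
exists [seq (u.1 ++ v.1, u.2 ++ v.2) | u <- s, v <- r]; apply/seteqP; split=> x /=.
  case=> -[u us [u1 u2]] [v vr [v1 v2]]; exists (u.1 ++ v.1, u.2 ++ v.2).
    by apply/allpairsP; exists (u, v).
  by split=> p /=; rewrite mem_cat => /orP[]; auto.
case=> _ /allpairsP[[u v] /= [us vr ->]] [/= h1 h2].
by split; [exists u|exists v] => //; split=> p pu; 
  [apply: h1|apply: h2|apply: h1|apply: h2]; rewrite mem_cat pu ?orbT.
Qed.

Lemma semialgebraic0 n : semialgebraic (set0 : set 'rV[R]_n).
Proof. by exists [::]; apply/seteqP; split=> x //= -[]. Qed.

Lemma semialgebraicT n : semialgebraic (setT : set 'rV[R]_n).
Proof.
exists [:: ([::], [::])]; apply/seteqP; split=> x //= _.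
by exists ([::], [::]); [exact: mem_head|].
Qed.

Lemma semialgebraic_gt0 n (p : mpoly n R) : semialgebraic [set x | 0 < peval x p].
Proof.
exists [:: ([::], [:: p])]; apply/seteqP; split=> x /=.
  move=> xp; exists ([::], [:: p]); first exact: mem_head.
  by split=> // q /=; rewrite inE => /eqP->.
by case=> PQ; rewrite inE => /eqP -> [_]; apply; rewrite inE.
Qed.

Lemma semialgebraic_eq0 n (p : mpoly n R) : semialgebraic [set x | peval x p = 0].
Proof.
exists [:: ([:: p], [::])]; apply/seteqP; split=> x /=.
  move=> xp; exists ([:: p], [::]); first exact: mem_head.
  by split=> // q /=; rewrite inE => /eqP->.
by case=> PQ; rewrite inE => /eqP -> [+ _]; apply; rewrite inE.
Qed.

Lemma semialgebraic_le0 n (p : mpoly n R) : semialgebraic [set x | ~ 0 < peval x p].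
Proof.
have -> : [set x | ~ 0 < peval x p] =
    [set x | peval x p = 0] `|` [set x | 0 < peval x (- p)].
  apply/seteqP; split=> x /=; rewrite /peval mevalN oppr_gt0.
    by move=> /negP; rewrite -leNgt le_eqVlt => /orP[/eqP|]; [left|right].
  by case=> [->|/ltW]; [rewrite ltxx|rewrite leNgt => /negP].
exact: semialgebraic_setU (semialgebraic_eq0 _) (semialgebraic_gt0 _).
Qed.

Lemma semialgebraic_setC n (A : set 'rV[R]_n) : semialgebraic A -> semialgebraic (~` A).
Proof.
case=> s; elim: s A => [|PQ s IH] A -> {A}.
  rewrite (_ : ~` _ = setT); first exact: semialgebraicT.
  by apply/seteqP; split=> x //= _ [].
have -> : ~` [set x | exists2 PQ0, PQ0 \in PQ :: s & basic_semialgebraic PQ0.1 PQ0.2 x] =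
   ~` basic_semialgebraic PQ.1 PQ.2 `&`
   ~` [set x | exists2 PQ0, PQ0 \in s & basic_semialgebraic PQ0.1 PQ0.2 x].
  apply/seteqP; split=> x /=.
    move=> H; split=> [h|[PQ0 P0s h]]; apply: H; first by exists PQ; rewrite // inE eqxx.
    by exists PQ0; rewrite // inE P0s orbT.
  by case=> H1 H2 [PQ0]; rewrite inE => /predU1P[->//|? ?]; apply: H2; exists PQ0.
apply: semialgebraic_setI; last exact: IH.
case: PQ => P Q /=; have -> : ~` basic_semialgebraic P Q =
    [set x | exists2 p, p \in P & peval x p <> 0] `|`
    [set x | exists2 q, q \in Q & ~ 0 < peval x q].
  apply/seteqP; split=> x /=.
    move=> /not_andP[/existsNP[p /not_implyP[pP h]]|/existsNP[q /not_implyP[qQ h]]].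
      by left; exists p.
    by right; exists q.
  by case=> -[p pP h] [h1 h2]; apply: h; [exact: h1|exact: h2].
apply: semialgebraic_setU.
  elim: P => [|p P IHP].
    by rewrite (_ : [set x | _] = set0); [exact: semialgebraic0|apply/seteqP; split=> x //= -[]].
  have -> : [set x | exists2 p0, p0 \in p :: P & peval x p0 <> 0] =
     [set x | 0 < peval x p] `|` [set x | 0 < peval x (- p)] `|`
     [set x | exists2 p0, p0 \in P & peval x p0 <> 0].
    apply/seteqP; split=> x /=; rewrite /peval mevalN oppr_gt0.
      case=> p0; rewrite inE => /predU1P[-> /eqP|p0P h]; last by right; exists p0.
      by rewrite neq_lt => /orP[]; left; [right|left].
    case=> [h|[p0 p0P h]]; last by exists p0; rewrite // inE p0P orbT.
    exists p; first by rewrite inE eqxx.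
    by apply/eqP; rewrite neq_lt orbC; apply/orP.
  by do 2?apply: semialgebraic_setU => //; exact: semialgebraic_gt0.
elim: Q => [|q Q IHQ].
  by rewrite (_ : [set x | _] = set0); [exact: semialgebraic0|apply/seteqP; split=> x //= -[]].
have -> : [set x | exists2 q0, q0 \in q :: Q & ~ 0 < peval x q0] =
   [set x | ~ 0 < peval x q] `|` [set x | exists2 q0, q0 \in Q & ~ 0 < peval x q0].
  apply/seteqP; split=> x /=.
    by case=> q0; rewrite inE => /predU1P[->|q0P] h; [left|right; exists q0].
  case=> [h|[q0 q0P h]]; last by exists q0; rewrite // inE q0P orbT.
  by exists q; rewrite // inE eqxx.
by apply: semialgebraic_setU => //; exact: semialgebraic_le0.
Qed.

(** The inductive class is made of the sets in disjunctive normal form because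
these are closed under complement: the negation of a sign condition is a
disjunction of sign conditions. *)
Lemma semialgebraicP n (A : set 'rV[R]_n) : semialgebraic A <-> sa A.
Proof.
split=> [[s ->]|].
  apply: (@sa_ext _ _ (fun x => exists2 PQ, PQ \in s &
    basic_semialgebraic PQ.1 PQ.2 x)); first by [].
  apply: sa_ex_seq => PQ _; apply: sa_and; apply: sa_all_seq => p _.
    by apply: sa_eq; [exact: polyfun_peval|exact: polyfun_cst].
  by apply: sa_gt0; exact: polyfun_peval.
elim=> {A} [f /polyfunP[p fp]|P _ /semialgebraic_setC//|P Q _ sP _ sQ].
  rewrite (_ : (fun _ => _) = [set x | 0 < peval x p]); first exact: semialgebraic_gt0.
  by apply/funext => x; rewrite fp.
exact: semialgebraic_setI sP sQ.
Qed.

End Semialgebra.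
Arguments polyfun {R T c}.
Arguments sa {R T c}.
Arguments polymap {R T U c d}.
Arguments polymap_id {R T c}.
Arguments polymap_fst {R T U c d}.
Arguments polymap_snd {R T U c d}.
Arguments polymap_comp {R T U V c d e h k}.
Arguments polymap_pair {R T U V c d e h k}.

(** * Real analytic germs in one variable *)

Section Analytic.
Variable R : realType.
Implicit Types (p q : {poly R}) (r x t : R) (a b c : nat -> R).

(** The weighted norm of the coefficients at radius [r]: it is submultiplicative
and bounds the values on the disc of radius [r]. *)
Definition nrm r p := \sum_(i < size p) `|p`_i| * r ^+ i.

Lemma nrmE n r p : (size p <= n)%N -> nrm r p = \sum_(i < n) `|p`_i| * r ^+ i.
Proof.
move=> pn; rewrite /nrm (big_ord_widen n (fun i => `|p`_i| * r ^+ i)) //.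
rewrite big_mkcond /=; apply: eq_bigr => i _; case: ltnP => // pi.
by rewrite nth_default // normr0 mul0r.
Qed.

Lemma nrm_ge0 r p : 0 <= r -> 0 <= nrm r p.
Proof. by move=> r0; apply: sumr_ge0 => i _; rewrite mulr_ge0 ?exprn_ge0. Qed.

Lemma nrm0 r : nrm r 0 = 0.
Proof. by rewrite /nrm size_poly0 big_ord0. Qed.

Lemma nrm_le_coef r p q : 0 <= r -> (forall i, `|p`_i| <= `|q`_i|) ->
  nrm r p <= nrm r q.
Proof.
move=> r0 pq; rewrite (nrmE r (leq_maxl (size p) (size q))).
rewrite (nrmE r (leq_maxr (size p) (size q))); apply: ler_sum => i _.
by rewrite ler_wpM2r ?exprn_ge0.
Qed.

Lemma nrm_add r p q : 0 <= r -> nrm r (p + q) <= nrm r p + nrm r q.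
Proof.
move=> r0; rewrite (nrmE r (leq_maxl (size p) (size q))).
rewrite (nrmE r (leq_maxr (size p) (size q))) (nrmE r (size_polyD p q)).
rewrite -big_split /=; apply: ler_sum => i _.
by rewrite -mulrDl coefD ler_wpM2r ?exprn_ge0 // ler_normD.
Qed.

Lemma nrmZ r k p : nrm r (k *: p) = `|k| * nrm r p.
Proof.
rewrite (nrmE r (size_scale_leq k p)) /nrm mulr_sumr; apply: eq_bigr => i _.
by rewrite coefZ normrM mulrA.
Qed.

Lemma nrmMX r p : nrm r (p * 'X) = r * nrm r p.
Proof.
have h : (size (p * 'X)%R <= (size p).+1)%N.
  by rewrite (leq_trans (size_polyMleq _ _)) // size_polyX addn2.
rewrite (nrmE r h) big_ord_recl coefMX eqxx normr0 mul0r add0r mulr_sumr.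
by apply: eq_bigr => i _; rewrite coefMX /= exprS mulrCA.
Qed.

Lemma nrmMXn r p n : nrm r (p * 'X^n) = r ^+ n * nrm r p.
Proof.
elim: n => [|n IH]; first by rewrite !expr0 mulr1 mul1r.
by rewrite exprSr mulrA nrmMX IH exprS mulrA.
Qed.

Lemma nrmMX_add r p k : nrm r (p * 'X + k%:P) = r * nrm r p + `|k|.
Proof.
have h : (size (p * 'X + k%:P)%R <= (size p).+1)%N.
  by rewrite size_MXaddC; case: ifP.
rewrite (nrmE r h) big_ord_recl coefD coefMX eqxx add0r coefC eqxx expr0 mulr1.
rewrite addrC; congr (_ + _); rewrite mulr_sumr; apply: eq_bigr => i _.
by rewrite coefD coefMX coefC /= addr0 exprS mulrCA.
Qed.

Lemma nrmM r p q : 0 <= r -> nrm r (p * q) <= nrm r p * nrm r q.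
Proof.
move=> r0; elim/poly_ind: p => [|p k IH]; first by rewrite mul0r nrm0 mul0r.
rewrite nrmMX_add mulrDl mulrAC mulrDl; apply: le_trans (nrm_add _ _ r0) _.
apply: lerD; last by rewrite mul_polyC nrmZ.
by rewrite nrmMX -mulrA ler_wpM2l.
Qed.

Lemma nrm_exp r p n : 0 <= r -> nrm r (p ^+ n) <= nrm r p ^+ n.
Proof.
move=> r0; elim: n => [|n IH].
  by rewrite !expr0 /nrm size_poly1 big_ord1 coef1 eqxx normr1 expr0 mulr1.
rewrite !exprS; apply: le_trans (nrmM _ _ r0) _.
by rewrite ler_wpM2l // nrm_ge0.
Qed.

Lemma nrm_sum r n (F : 'I_n -> {poly R}) : 0 <= r ->
  nrm r (\sum_(j < n) F j) <= \sum_(j < n) nrm r (F j).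
Proof.
move=> r0; elim: n F => [|n IH] F; first by rewrite !big_ord0 nrm0.
rewrite !big_ord_recl; apply: le_trans (nrm_add _ _ r0) _.
by rewrite lerD2l.
Qed.

Lemma nrm_take r m p : 0 <= r -> nrm r (take_poly m p) <= nrm r p.
Proof.
by move=> r0; apply: nrm_le_coef => // i; rewrite coef_take_poly; case: ifP; rewrite ?normr0.
Qed.

Lemma nrm_small r r' p : p`_0 = 0 -> 0 < r -> 0 <= r' <= r ->
  nrm r' p <= r' / r * nrm r p.
Proof.
move=> p0 r0 /andP[r'0 r'r]; rewrite /nrm mulr_sumr; apply: ler_sum => -[[|i] Hi] _ /=.
  by rewrite p0 normr0 !mul0r mulr0.
have -> : r' / r * (`|p`_i.+1| * r ^+ i.+1) = `|p`_i.+1| * (r' * r ^+ i).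
  by rewrite exprS; field; rewrite gt_eqF.
by rewrite ler_wpM2l // exprS ler_wpM2l // lerXn2r // nnegrE // ltW.
Qed.

Lemma nrm_le_r r r' p : 0 <= r' <= r -> nrm r' p <= nrm r p.
Proof.
move=> /andP[r'0 r'r]; apply: ler_sum => i _; rewrite ler_wpM2l // lerXn2r //.
by rewrite nnegrE (le_trans r'0).
Qed.

Lemma horner_nrm r p x : `|x| <= r -> `|p.[x]| <= nrm r p.
Proof.
move=> xr; rewrite horner_coef; apply: le_trans (ler_norm_sum _ _ _) _.
apply: ler_sum => i _; rewrite normrM normrX ler_wpM2l // lerXn2r //.
by rewrite nnegrE (le_trans _ xr).
Qed.

(** Halving the radius makes a high order remainder exponentially small. *)
Lemma horner_nrm_tail r p x m : 0 < r -> (forall k, (k < m)%N -> p`_k = 0) ->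
  `|x| <= r / 2 -> `|p.[x]| <= nrm r p * 2^-1 ^+ m.
Proof.
move=> r0 pm xr; apply: le_trans (horner_nrm _ xr) _.
rewrite /nrm mulr_suml; apply: ler_sum => i _.
have [im|mi] := ltnP i m; first by rewrite (pm _ im) normr0 !mul0r.
rewrite -mulrA ler_wpM2l // exprMn ler_wpM2l ?exprn_ge0 ?(ltW r0) //.
by rewrite ler_wiXn2l //; lra.
Qed.

Definition trunc m a : {poly R} := \poly_(i < m) a i.

Lemma coef_trunc m a i : (trunc m a)`_i = if (i < m)%N then a i else 0.
Proof. exact: coef_poly. Qed.

Lemma size_trunc m a : (size (trunc m a) <= m)%N.
Proof. exact: size_poly. Qed.

Lemma pseriesE a x m : pseries a x m = (trunc m a).[x].
Proof. by rewrite /pseries /series /= big_mkord horner_poly. Qed.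

Lemma pseries_trunc a x : pseries a x = fun m => (trunc m a).[x].
Proof. by apply/funext => m; rewrite pseriesE. Qed.

(** Absolute convergence is recorded as a uniform bound on the norms of the
truncations, so that the estimates are made on polynomials. *)
Definition power_rep a r M t0 (g : R -> R) :=
  [/\ 0 < r, forall m, nrm r (trunc m a) <= M &
      forall t, `|t - t0| <= r -> (trunc m a).[t - t0] @[m --> \oo] --> g t].

Lemma nrm_trunc r a m : nrm r (trunc m a) = \sum_(i < m) `|a i| * r ^+ i.
Proof.
by rewrite (nrmE _ (size_trunc m a)); apply: eq_bigr => i _; rewrite coef_trunc ltn_ord.
Qed.

Lemma analytic_power_rep g t0 : real_analytic_at g t0 ->
  exists a r M, power_rep a r M t0 g.
Proof.
move=> [a /nbhs_ballP[e /= e0 ae]].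
have e4 : 0 < e / 4 by lra.
have cv : cvgn (pseries a (e / 2)).
  have := ae (t0 + e / 2); rewrite [t0 + _ - _]addrC addKr => H.
  apply/cvg_ex; exists (g (t0 + e / 2)); apply: H.
  rewrite /ball /= opprD addrA subrr sub0r normrN ger0_norm; lra.
have cv' : cvgn (pseries (fun i => `|a i|) (e / 4)).
  apply: (is_cvg_pseries_inside_norm cv); rewrite !ger0_norm; lra.
exists a, (e / 4), (limn (pseries (fun i => `|a i|) (e / 4))); split => //.
  move=> m; rewrite nrm_trunc.
  have -> : \sum_(i < m) `|a i| * (e / 4) ^+ i = pseries (fun i => `|a i|) (e / 4) m.
    by rewrite /pseries /series /= big_mkord.
  apply: nondecreasing_cvgn_le cv' _; apply/nondecreasing_seqP => n.
  by rewrite !pseriesE !horner_poly big_ord_recr /= lerDl mulr_ge0 ?exprn_ge0 ?(ltW e4).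
move=> t tr; have := ae t; rewrite /= pseries_trunc; apply.
by rewrite /ball /= distrC (le_lt_trans tr) //; lra.
Qed.

Lemma power_rep_analytic a r M t0 g : power_rep a r M t0 g -> real_analytic_at g t0.
Proof.
move=> [r0 _ H]; exists a; apply/nbhs_ballP; exists r => //= t tr.
rewrite /= pseries_trunc; apply: H; rewrite distrC; exact: ltW.
Qed.

Lemma power_rep_le a r M r' M' t0 g : 0 < r' <= r -> M <= M' ->
  power_rep a r M t0 g -> power_rep a r' M' t0 g.
Proof.
move=> /andP[r'0 r'r] MM [r0 aM ag]; split => // [m|t tr].
  by rewrite (le_trans _ MM) // (le_trans _ (aM m)) // nrm_le_r // r'r ltW.
by apply: ag; rewrite (le_trans tr).
Qed.

(** Coefficients of order at least [m] of [P m] may be dropped in the limit.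
This is how an identity between power series is deduced from one between
polynomials: for a product, [P m] is the product of the truncations. *)
Lemma trunc_limit c r (M : R) x (P : nat -> {poly R}) (l : R) : 0 < r ->
  (forall m, trunc m c = take_poly m (P m)) -> (forall m, nrm r (P m) <= M) ->
  `|x| <= r / 2 -> (P m).[x] @[m --> \oo] --> l ->
  (trunc m c).[x] @[m --> \oo] --> l.
Proof.
move=> r0 cP PM xr Pl.
pose D m := P m - take_poly m (P m).
have D0 : (D m).[x] @[m --> \oo] --> 0.
  apply/norm_cvg0P; apply: (@squeeze_cvgr _ _ _ _ (fun=> 0) (geometric M 2^-1)).
  - near=> m; rewrite normr_ge0 /=.
    apply: le_trans (@horner_nrm_tail r _ _ m r0 _ xr) _.
      by move=> k km; rewrite coefB coef_take_poly km subrr.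
    rewrite ler_wpM2r ?exprn_ge0 //; apply: le_trans (PM m).
    apply: nrm_le_coef => [|i]; first exact: ltW.
    by rewrite coefB coef_take_poly; case: ifP; rewrite ?subrr ?subr0 ?normr0.
  - exact: cvg_cst.
  - by apply: cvg_geometric; rewrite ger0_norm; lra.
rewrite -[l]subr0; under eq_fun => m.
  have -> : trunc m c = P m - D m by rewrite cP /D opprB addrC subrK.
  rewrite hornerD hornerN.
over.
exact: cvgB.
Unshelve. all: by end_near.
Qed.

Lemma analytic_near g h t0 : (\forall t \near t0, g t = h t) ->
  real_analytic_at g t0 -> real_analytic_at h t0.
Proof.
move=> gh [a ag]; exists a; near=> t.
by have <- : g t = h t by [near: t]; near: t.
Unshelve. all: by end_near.
Qed.

Lemma analytic_cst k t0 : real_analytic_at (fun=> k : R) t0.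
Proof.
exists (fun i => if i == 0%N then k else 0); near=> t.
apply: cvg_near_cst; near=> m.
rewrite pseriesE horner_poly.
have m0 : (0 < m)%N by near: m; exact: nbhs_infty_gt.
rewrite -(prednK m0) big_ord_recl /= mulr1 big1 ?addr0 // => i _.
by rewrite mul0r.
Unshelve. all: by end_near.
Qed.

Lemma analytic_id t0 : real_analytic_at (@id R) t0.
Proof.
exists (fun i => if i == 0%N then t0 else (i == 1)%:R); near=> t.
apply: cvg_near_cst; near=> m.
rewrite pseriesE horner_poly.
have m1 : (1 < m)%N by near: m; exact: nbhs_infty_gt.
rewrite -(subnKC m1) !big_ord_recl /= big1 => [|i _].
  by rewrite mulr1 mul1r addr0 addrC subrK.
by rewrite mul0r.
Unshelve. all: by end_near.
Qed.

Lemma trunc_add m a b : trunc m (fun i => a i + b i) = trunc m a + trunc m b.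
Proof. by apply/polyP => i; rewrite coefD !coef_trunc; case: ifP; rewrite ?addr0. Qed.

Lemma analytic_add g h t0 : real_analytic_at g t0 -> real_analytic_at h t0 ->
  real_analytic_at (fun t => g t + h t) t0.
Proof.
move=> [a ag] [b bh]; exists (fun i => a i + b i); near=> t.
rewrite pseries_trunc; under eq_fun do rewrite trunc_add hornerD -!pseriesE.
by apply: cvgD; near: t.
Unshelve. all: by end_near.
Qed.

(** The Cauchy product: its truncations are those of the products of the
truncations. *)
Lemma analytic_mul g h t0 : real_analytic_at g t0 -> real_analytic_at h t0 ->
  real_analytic_at (fun t => g t * h t) t0.
Proof.
move=> /analytic_power_rep[a [r [M [r0 aM ag]]]].
move=> /analytic_power_rep[b [s [N [s0 bN bh]]]].
pose c k := \sum_(i < k.+1) a i * b (k - i)%N.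
have cE m : trunc m c = take_poly m (trunc m a * trunc m b).
  apply/polyP => k; rewrite coef_trunc coef_take_poly; case: ifP => // km.
  rewrite coefM; apply: eq_bigr => i _; rewrite !coef_trunc.
  by rewrite (leq_ltn_trans _ km) ?leq_ord // (leq_ltn_trans _ km) ?leq_subr.
pose u := Num.min r s.
have u0 : 0 < u by rewrite lt_min r0.
have M0 : 0 <= M by apply: le_trans (aM 0%N); apply: nrm_ge0; exact: ltW.
exists c; apply/nbhs_ballP; exists (u / 2) => /=; first by rewrite divr_gt0.
move=> t /ltW; rewrite distrC => tu; rewrite /= pseries_trunc.
have tu' : `|t - t0| <= u by rewrite (le_trans tu) //; lra.
apply: (@trunc_limit c u (M * N) _ (fun m => trunc m a * trunc m b)) => //.
  move=> m; apply: le_trans (nrmM _ _ (ltW u0)) _; apply: ler_pM.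
  - exact/nrm_ge0/ltW.
  - exact/nrm_ge0/ltW.
  - by apply: le_trans (aM m); apply: nrm_le_r; rewrite ltW // ge_min lexx.
  - by apply: le_trans (bN m); apply: nrm_le_r; rewrite ltW // ge_min lexx orbT.
under eq_fun do rewrite hornerM.
apply: cvgM; [apply: ag|apply: bh]; rewrite (le_trans tu') // ge_min lexx ?orbT //.
Qed.

Lemma analytic_sum I (s : seq I) (g : I -> R -> R) t0 :
  (forall i, real_analytic_at (g i) t0) ->
  real_analytic_at (fun t => \sum_(i <- s) g i t) t0.
Proof.
move=> gi; elim: s => [|i s IH].
  by under eq_fun do rewrite big_nil; exact: analytic_cst.
by under eq_fun do rewrite big_cons; exact: analytic_add.
Qed.

Lemma analytic_exp g n t0 : real_analytic_at g t0 ->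
  real_analytic_at (fun t => g t ^+ n) t0.
Proof.
move=> ga; elim: n => [|n IH]; first exact: (analytic_cst 1).
by under eq_fun do rewrite exprS; exact: analytic_mul.
Qed.

Lemma analytic_affine g k l t0 : real_analytic_at g (k * t0 + l) ->
  real_analytic_at (fun t => g (k * t + l)) t0.
Proof.
move=> [a ag]; exists (fun i => a i * k ^+ i).
have cv : (fun t => k * t + l) @ t0 --> k * t0 + l.
  by apply: cvgD; [apply: cvgM; [exact: cvg_cst|exact: cvg_id]|exact: cvg_cst].
have {}cv : \forall t \near t0,
  pseries a (k * t + l - (k * t0 + l)) @ \oo --> g (k * t + l) by exact: (cv _ ag).
near=> t; have : pseries a (k * t + l - (k * t0 + l)) @ \oo --> g (k * t + l).
  by near: t.
rewrite opprD addrACA subrr addr0 -mulrBr.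
suff -> : pseries a (k * (t - t0)) = pseries (fun i => a i * k ^+ i) (t - t0) by [].
rewrite /pseries; apply/funext => m; rewrite /series /=.
by apply: eq_bigr => i _; rewrite exprMn mulrA.
Unshelve. all: by end_near.
Qed.

Lemma power_rep_bound a r M t0 g t : power_rep a r M t0 g -> `|t - t0| <= r ->
  `|g t - a 0%N| <= `|t - t0| / r * M.
Proof.
move=> [r0 aM ag] tr; set x := t - t0 in tr *.
have : `|(trunc m a).[x] - a 0%N| @[m --> \oo] --> `|g t - a 0%N|.
  by apply: cvg_norm; apply: cvgB; [exact: ag|exact: cvg_cst].
apply: (closed_cvg (fun y => y <= `|x| / r * M)); first exact: closed_le.
near=> m; have m0 : (0 < m)%N by near: m; exact: nbhs_infty_gt.
pose p := trunc m a - (a 0%N)%:P.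
have -> : (trunc m a).[x] - a 0%N = p.[x] by rewrite hornerD hornerN hornerC.
have p0 : p`_0 = 0 by rewrite coefB coefC eqxx coef_trunc m0 subrr.
apply: le_trans (horner_nrm p (lexx `|x|)) _.
apply: le_trans (nrm_small p0 r0 _) _; first by rewrite normr_ge0.
rewrite ler_wpM2l ?divr_ge0 ?(ltW r0) //; apply: le_trans (aM m).
apply: nrm_le_coef => [|[|i]]; first exact: ltW.
  by rewrite p0 normr0.
by rewrite coefB coefC subr0.
Unshelve. all: by end_near.
Qed.

Lemma power_rep0 a r M t0 g : power_rep a r M t0 g -> g t0 = a 0%N.
Proof.
move=> H; have [r0 _ _] := H; have := power_rep_bound (t := t0) H.
rewrite subrr normr0 !mul0r => /(_ (ltW r0)); rewrite normr_le0 subr_eq0.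
by move/eqP.
Qed.

Lemma analytic_continuous g t0 : real_analytic_at g t0 -> g t @[t --> t0] --> g t0.
Proof.
move=> /analytic_power_rep[a [r [M H]]]; have [r0 aM _] := H.
have M0 : 0 <= M by apply: le_trans (aM 0%N); apply: nrm_ge0; exact: ltW.
apply/cvgrPdist_le => e e0; apply/nbhs_ballP.
have d0 : 0 < Num.min r (e * r / (M + 1)).
  by rewrite lt_min r0 divr_gt0 ?mulr_gt0 ?ltr_wpDl.
exists (Num.min r (e * r / (M + 1))) => //= t /=; rewrite lt_min => /andP[].
rewrite distrC => tr te; rewrite (power_rep0 H) distrC.
apply: le_trans (power_rep_bound H (ltW tr)) _.
move: te; rewrite ltr_pdivlMr ?ltr_wpDl // distrC => te.
rewrite mulrAC ler_pdivrMr //; apply: le_trans (ltW te).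
by rewrite ler_wpM2l // lerDl.
Qed.

(** Near its centre, a germ is dominated by the term of its first nonzero
coefficient. *)
Lemma analytic_zeros g t0 : real_analytic_at g t0 ->
  (\forall t \near t0, g t = 0) \/ (\forall t \near t0, t != t0 -> g t != 0).
Proof.
move=> /analytic_power_rep[a [r [M H]]]; have [r0 aM ag] := H.
have [a0|/existsNP[k /eqP ak]] := pselect (forall k, a k = 0).
  left; apply/nbhs_ballP; exists r => //= t; rewrite /ball /= distrC => /ltW /ag.
  have tr0 m : trunc m a = 0 by apply/polyP => i; rewrite coef_trunc a0 if_same coef0.
  under eq_fun do rewrite tr0 horner0.
  by move/cvg_lim => <- //; rewrite lim_cst.
right; have exk : exists k, a k != 0 by exists k.
pose m := ex_minn exk.
have [am mmin] : a m != 0 /\ forall i, (i < m)%N -> a i = 0.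
  rewrite /m; case: ex_minnP => j aj jmin; split => // i ij.
  by apply: contraTeq ij => /jmin; rewrite leqNgt.
pose b i := a (m + i)%N.
have bE n : trunc (m + n) a = trunc n b * 'X^m.
  apply/polyP => i; rewrite coefMXn !coef_trunc.
  case: (ltnP i m) => im; first by rewrite (mmin _ im) if_same.
  by rewrite -{1}(subnKC im) ltn_add2l /b subnKC.
have nb n : nrm r (trunc n b) <= M / r ^+ m.
  rewrite ler_pdivlMr ?exprn_gt0 //; apply: le_trans (aM (m + n)%N); rewrite bE.
  by rewrite nrmMXn mulrC.
pose h t := if t == t0 then a m else g t / (t - t0) ^+ m.
have Hh : power_rep b r (M / r ^+ m) t0 h.
  split=> // t tr; rewrite /h; have [->|tt0] := eqVneq t t0.
    apply: cvg_near_cst; near=> n; have : (0 < n)%N by near: n; exact: nbhs_infty_gt.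
    by rewrite subrr horner_coef0 coef_trunc => ->; rewrite /b addn0.
  have x0 : (t - t0) ^+ m != 0 by rewrite expf_eq0 subr_eq0 (negPf tt0) andbF.
  have E n : (trunc n b).[t - t0] = (trunc (n + m) a).[t - t0] / (t - t0) ^+ m.
    by rewrite addnC bE hornerM hornerXn mulfK.
  under eq_fun do rewrite E.
  apply: cvgM; last exact: cvg_cst.
  by have := ag t tr; rewrite -(cvg_shiftn m).
have N0 : 0 <= M / r ^+ m.
  by apply: le_trans (nb 0%N); apply: nrm_ge0; exact: ltW.
set N := M / r ^+ m in nb Hh N0.
apply/nbhs_ballP; exists (Num.min r (`|a m| * r / (N + 1))) => //=.
  by rewrite lt_min r0 !divr_gt0 ?mulr_gt0 ?ltr_wpDl ?normr_gt0.
move=> t; rewrite /ball /= distrC lt_min => /andP[tr te] tt0; apply/eqP => gt0.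
have := power_rep_bound Hh (ltW tr).
rewrite /h (negPf tt0) gt0 mul0r sub0r normrN /b addn0 leNgt => /negP; apply.
move: te; rewrite ltr_pdivlMr ?ltr_wpDl // => te.
rewrite mulrAC ltr_pdivrMr //; apply: le_lt_trans te.
by rewrite ler_wpM2l // lerDl.
Unshelve. all: by end_near.
Qed.

End Analytic.

(** * The implicit function theorem for simple roots *)

Section ImplicitFunction.
Variable R : realType.
Implicit Types (p q : {poly R}) (r s x t : R).

(** The equation [w = sum_j F_j(x) w^j] is solved by iteration, on truncated
polynomials.  [B] bounds the norms of the coefficients [F_j], and the inequality
[Bs] makes the ball of radius [s] stable under the iteration. *)
Section FormalSolution.
Variables (D : nat) (F : nat -> nat -> R) (r s : R) (B : nat -> R).
Hypotheses (r0 : 0 < r) (s0 : 0 <= s).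
Hypotheses (F00 : F 0 0 = 0) (F10 : F 1 0 = 0).
Hypothesis nF : forall j m, (j < D)%N -> nrm r (trunc m (F j)) <= B j.
Hypothesis Bs : \sum_(j < D) B j * s ^+ j <= s.

Let Psi m q : {poly R} := \sum_(j < D) trunc m (F j) * q ^+ j.

Fixpoint approx m : {poly R} :=
  if m is k.+1 then take_poly k.+1 (Psi k.+1 (approx k)) else 0.

Lemma nrm_Psi m q : nrm r q <= s -> nrm r (Psi m q) <= s.
Proof.
move=> qs; apply: le_trans (nrm_sum _ (ltW r0)) _; apply: le_trans Bs.
apply: ler_sum => j _; apply: le_trans (nrmM _ _ (ltW r0)) _.
apply: ler_pM; [exact/nrm_ge0/ltW|exact/nrm_ge0/ltW|exact: nF|].
apply: le_trans (nrm_exp _ _ (ltW r0)) _; rewrite lerXn2r // nnegrE.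
exact/nrm_ge0/ltW.
Qed.

Lemma nrm_approx m : nrm r (approx m) <= s.
Proof.
elim: m => [|m IH] /=; first by rewrite nrm0.
apply: le_trans (nrm_take _ _ (ltW r0)) _; exact: nrm_Psi.
Qed.

Lemma approx0 m : (approx m)`_0 = 0.
Proof.
elim: m => [|m IH] /=; first by rewrite coef0.
rewrite coef_take_poly /= coef_sum big1 // => -[[|[|j]] Hj] _ /=.
- by rewrite expr0 mulr1 coef_trunc.
- by rewrite expr1 coef0M coef_trunc F10 mul0r.
- by rewrite exprS coef0M coef0M IH mul0r mulr0.
Qed.

Lemma dvdXnP n p : reflect (forall k, (k < n)%N -> p`_k = 0) ('X^n %| p).
Proof.
apply: (iffP idP) => [/dvdpP[u ->] k kn|pn]; first by rewrite coefMXn kn.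
rewrite -(poly_take_drop n p) (_ : take_poly n p = 0) ?add0r ?dvdp_mulIr //.
by apply/polyP => i; rewrite coef_take_poly coef0; case: ifP => // /pn.
Qed.

Lemma take_eqP n p q : reflect (take_poly n p = take_poly n q) ('X^n %| p - q).
Proof.
apply: (iffP (dvdXnP _ _)) => [pq|pq k kn].
  apply/polyP => i; rewrite !coef_take_poly; case: ifP => // /pq.
  by rewrite coefB => /eqP; rewrite subr_eq0 => /eqP.
have := congr1 (fun u : {poly R} => u`_k) pq.
by rewrite !coef_take_poly kn coefB => ->; rewrite subrr.
Qed.

(** Because the linear coefficient of the equation vanishes at the centre,
each iteration determines one more coefficient of the solution. *)
Lemma Psi_contract m p q : p`_0 = 0 -> q`_0 = 0 -> dvdp 'X^m (p - q) ->
  dvdp 'X^(m.+1) (Psi m.+2 p - Psi m.+1 q).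
Proof.
move=> p0 q0 pq; rewrite -sumrB.
suff H j : (j < D)%N -> dvdp 'X^(m.+1) (trunc m.+2 (F j) * p ^+ j - trunc m.+1 (F j) * q ^+ j).
  by elim/big_ind: _ => [|u v|j _]; [exact: dvdp0|exact: dvdp_add|exact: H].
move=> jD.
have -> : trunc m.+2 (F j) * p ^+ j - trunc m.+1 (F j) * q ^+ j =
  (trunc m.+2 (F j) - trunc m.+1 (F j)) * p ^+ j + trunc m.+1 (F j) * (p ^+ j - q ^+ j).
  by rewrite mulrBl mulrBr addrA subrK.
apply: dvdp_add.
  apply/dvdp_mulr/dvdXnP => k km; rewrite coefB !coef_trunc km.
  by rewrite (ltn_trans km) // subrr.
have X1 (u : {poly R}) : u`_0 = 0 -> dvdp 'X u.
  by move=> u0; rewrite -['X]expr1; apply/dvdXnP => -[].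
rewrite exprSr; case: j {jD} => [|[|j]].
- by rewrite subrr mulr0 dvdp0.
- by rewrite !expr1 mulrC dvdp_mul // X1 // coef_trunc F10.
- apply: dvdp_mull; rewrite subrXX; apply: dvdp_mul => //.
  elim/big_ind: _ => [|u v|i _]; [exact: dvdp0|exact: dvdp_add|].
  case: i => -[|i] Hi /=.
    by rewrite subn0 exprS -mulrA; apply/dvdp_mulr/X1.
  by rewrite exprSr mulrA; apply/dvdp_mull/X1.
Qed.

Lemma approx_stable m : take_poly m (approx m.+1) = approx m.
Proof.
elim: m => [|m IH]; first by rewrite take_poly0l.
have tk : take_poly m (approx m) = approx m.
  apply: take_poly_id; case: m {IH} => [|m]; first by rewrite size_poly0.
  exact: size_take_poly.
have /(Psi_contract (approx0 m.+1) (approx0 m))/take_eqP E :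
  dvdp 'X^m (approx m.+1 - approx m) by apply/take_eqP; rewrite IH.
rewrite [RHS]/= -E; apply/polyP => i; rewrite [approx m.+2]/= !coef_take_poly.
by case: ifP => // im; rewrite (ltn_trans im).
Qed.

Definition solution k := (approx k.+1)`_k.

Lemma trunc_solution m : trunc m solution = approx m.
Proof.
elim: m => [|m IH]; first by apply/polyP => i; rewrite coef_trunc coef0.
apply/polyP => i; rewrite coef_trunc ltnS leq_eqVlt.
have Ei : (take_poly m (approx m.+1))`_i = (trunc m solution)`_i.
  by rewrite approx_stable IH.
have [->|ne] := eqVneq i m; first by [].
rewrite coef_take_poly coef_trunc in Ei; case: ltnP Ei => [im -> //|mi _].
by rewrite /= coef_take_poly ltnS leqNgt ltn_neqAle eq_sym ne mi.
Qed.

Lemma cvgn_exp (u : nat -> R) (l : R) j : u m @[m --> \oo] --> l ->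
  u m ^+ j @[m --> \oo] --> l ^+ j.
Proof.
move=> ul; elim: j => [|j IH]; first exact: cvg_cst.
by under eq_fun do rewrite exprS; rewrite exprS; exact: cvgM.
Qed.

Lemma cvgn_sum n (u : nat -> nat -> R) (l : nat -> R) :
  (forall j, (j < n)%N -> u j m @[m --> \oo] --> l j) ->
  \sum_(j < n) u j m @[m --> \oo] --> \sum_(j < n) l j.
Proof.
elim: n => [|n IH] ul.
  by under eq_fun do rewrite big_ord0; rewrite big_ord0; exact: cvg_cst.
under eq_fun do rewrite big_ord_recr; rewrite big_ord_recr /=.
by apply: cvgD; [apply: IH => j jn; apply: ul; exact: ltnW|exact: ul].
Qed.

Lemma solution_cvg x : `|x| <= r -> cvgn (fun m => (trunc m solution).[x]).
Proof.
move=> xr; rewrite -pseries_trunc; apply: normed_cvg.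
rewrite (_ : [normed _] = fun m => \sum_(i < m) `|solution i * x ^+ i|); last first.
  by apply/funext => m; rewrite /= /series /= big_mkord.
apply: nondecreasing_is_cvgn.
  apply/nondecreasing_seqP => n.
  by rewrite big_ord_recr /= lerDl.
exists s => _ [m _ <-].
apply: le_trans (nrm_approx m); rewrite -trunc_solution nrm_trunc.
by apply: ler_sum => i _; rewrite normrM normrX ler_wpM2l // lerXn2r // nnegrE ltW.
Qed.

(** The truncations of the solution satisfy the equation up to high order
terms of bounded norm, which vanish in the limit at half the radius. *)
Lemma solution_root x (f : nat -> R) : `|x| <= r / 2 ->
  (forall j, (j < D)%N -> (trunc m (F j)).[x] @[m --> \oo] --> f j) ->
  exists2 y : R, (trunc m solution).[x] @[m --> \oo] --> y & y = \sum_(j < D) f j * y ^+ j.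
Proof.
move=> xr Ff.
have xr' : `|x| <= r by move: (r0) xr => ?; lra.
have /cvg_ex[/= y Hy] := solution_cvg xr'.
exists y => //.
pose P m := if m is k.+1 then Psi k.+1 (approx k) else 0.
have HP : (P m).[x] @[m --> \oo] --> \sum_(j < D) f j * y ^+ j.
  rewrite -cvg_shiftS /=.
  have E n : (Psi n.+1 (approx n)).[x] =
    \sum_(j < D) (trunc n.+1 (F j)).[x] * (trunc n solution).[x] ^+ j.
    rewrite horner_sum; apply: eq_bigr => j _.
    by rewrite hornerM horner_exp trunc_solution.
  under eq_fun do rewrite E.
  apply: (@cvgn_sum D (fun j n => (trunc n.+1 (F j)).[x] * (trunc n solution).[x] ^+ j)
    (fun j => f j * y ^+ j)) => j jD.
  apply: cvgM; last exact: cvgn_exp.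
  by rewrite (cvg_shiftS (fun n => (trunc n (F j)).[x])); exact: Ff.
apply: (cvg_unique _ Hy) => //.
apply: (@trunc_limit _ solution r s x P) => //.
- by move=> [|m]; rewrite trunc_solution //= take_poly0l.
- by move=> [|m]; rewrite /= ?nrm0 //; apply/nrm_Psi/nrm_approx.
Qed.

End FormalSolution.

Lemma power_rep_family D (g : nat -> R -> R) t0 :
  (forall j, real_analytic_at (g j) t0) ->
  exists F r M, forall j, (j < D)%N -> power_rep (F j) r M t0 (g j).
Proof.
move=> ga; have /choice[F] : forall j, exists a, exists r M, power_rep a r M t0 (g j).
  by move=> j; apply: analytic_power_rep.
move=> HF; exists F.
suff [r [M [_ ?]]] : exists r M, 0 < r /\ forall j, (j < D)%N ->
  power_rep (F j) r M t0 (g j) by exists r, M.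
elim: D => [|D [r [M [r0 IH]]]]; first by exists 1, 0.
have [r' [M' H']] := HF D; have [r'0 _ _] := H'.
exists (Num.min r r'), (Num.max M M'); split=> [|j]; first by rewrite lt_min r0.
rewrite ltnS leq_eqVlt => /predU1P[->|jD].
  by apply: power_rep_le H'; rewrite ?lt_min ?r0 ?r'0 ?ge_min ?le_max ?lexx ?orbT.
by apply: power_rep_le (IH _ jD); rewrite ?lt_min ?r0 ?r'0 ?ge_min ?le_max ?lexx ?orbT.
Qed.

(** On a small disc the terms of degree 0 and 1 are small because [g_0] and
[g_1] vanish at the centre, and the terms of degree at least 2 are small on a
small ball of values of [w]. *)
Lemma fixpoint_analytic D (g : nat -> R -> R) t0 :
  (forall j, real_analytic_at (g j) t0) -> g 0 t0 = 0 -> g 1 t0 = 0 ->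
  exists w, [/\ real_analytic_at w t0, w t0 = 0 &
    \forall t \near t0, w t = \sum_(j < D.+2) g j t * w t ^+ j].
Proof.
move=> ga g00 g10.
have [F [r1 [M HF]]] := power_rep_family D.+2 ga.
have [r10 nF _] := HF 0%N isT.
have F00 : F 0 0 = 0 by rewrite -(power_rep0 (HF 0%N isT)).
have F10 : F 1 0 = 0 by rewrite -(power_rep0 (HF 1%N isT)).
have M0 : 0 <= M by apply: le_trans (nF 0%N); apply: nrm_ge0; exact: ltW.
pose K : R := D%:R + 1; have K0 : 1 <= K by rewrite lerDr.
(* [s] makes the terms of degree at least two contract; then [r] shrinks the
constant and linear terms. *)
have [s sE] : exists s, s = (4 * K * (M + 1))^-1 by exists (4 * K * (M + 1))^-1.
have s0 : 0 < s by rewrite sE invr_gt0 !mulr_gt0 //; lra.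
have s1 : s <= 1.
  rewrite sE invf_le1 ?mulr_gt0 //; try lra.
  by rewrite -[1]mulr1; apply: ler_pM; rewrite ?mulr_ge0 //; lra.
have sK : s * (4 * K * (M + 1)) = 1.
  by rewrite sE mulVf // gt_eqF // !mulr_gt0 //; lra.
pose r := r1 * (s / (4 * (M + 1))).
have M1 : 0 < 4 * (M + 1) by lra.
have rr0 : 0 < r by rewrite mulr_gt0 // divr_gt0.
have rr1 : r <= r1.
  rewrite ger_pMr // ler_pdivrMr // mul1r (le_trans s1) //; lra.
have rM : r / r1 * M <= s / 4.
  have -> : r / r1 = s / (4 * (M + 1)) by rewrite /r mulrC mulKf // gt_eqF.
  rewrite mulrAC ler_pdivrMr //; have : 0 <= s by exact: ltW.
  nra.
pose B j := if (j < 2)%N then s / 4 else M.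
have nF' j m : (j < D.+2)%N -> nrm r (trunc m (F j)) <= B j.
  move=> jD; have [_ nFj _] := HF j jD; rewrite /B.
  case: ifP => j2; last first.
    by apply: le_trans (nFj m); apply: nrm_le_r; rewrite (ltW rr0).
  apply: le_trans rM; apply: le_trans (_ : _ <= r / r1 * nrm r1 (trunc m (F j))) _.
    apply: nrm_small => //; last by rewrite (ltW rr0).
    by rewrite coef_trunc; case: ifP => // _; case: j j2 {jD nFj} => [|[]].
  by rewrite ler_wpM2l // divr_ge0 // ltW.
have Bs : \sum_(j < D.+2) B j * s ^+ j <= s.
  have -> : \sum_(j < D.+2) B j * s ^+ j =
      s / 4 + s / 4 * s + \sum_(i < D) M * s ^+ i.+2.
    by rewrite 2!big_ord_recl addrA; congr (_ + _ + _); exact: mulr1.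
  have : \sum_(i < D) M * s ^+ i.+2 <= \sum_(i < D) M * s ^+ 2.
    apply: ler_sum => i _; rewrite ler_wpM2l // ler_wiXn2l //; exact: ltW.
  rewrite sumr_const card_ord -[_ *+ D]mulr_natr => H.
  have h4 : M * s ^+ 2 * D%:R <= s / 4.
    have -> : s / 4 = s ^+ 2 * (K * (M + 1)).
      have -> : s ^+ 2 * (K * (M + 1)) = s / 4 * (s * (4 * K * (M + 1))) by field.
      by rewrite sK mulr1.
    have -> : M * s ^+ 2 * D%:R = s ^+ 2 * (D%:R * M) by ring.
    rewrite ler_wpM2l ?exprn_ge0 ?(ltW s0) //.
    by apply: ler_pM => //; rewrite lerDl.
  have h5 : s / 4 * s <= s / 4 by rewrite ger_pMr //; lra.
  apply: le_trans (_ : s / 4 + s / 4 + s / 4 <= s); last by lra.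
  by rewrite lerD ?lerD2l ?(le_trans H).
have sol := solution_root rr0 (ltW s0) F00 F10 nF' Bs.
pose w t : R := limn (fun m => (trunc m (solution D.+2 F)).[t - t0]).
have wP t : `|t - t0| <= r / 2 ->
   (trunc m (solution D.+2 F)).[t - t0] @[m --> \oo] --> w t /\
   w t = \sum_(j < D.+2) g j t * w t ^+ j.
  move=> tr; have [|y Hy yE] := sol (t - t0) (fun j => g j t) tr.
    move=> j jD; have [_ _ ] := HF j jD; apply.
    by apply: le_trans tr _; lra.
  by have -> : w t = y by apply/cvg_lim.
have wrep : power_rep (solution D.+2 F) (r / 2) s t0 w.
  split; first by rewrite divr_gt0.
    move=> m; rewrite trunc_solution //.
    apply: le_trans (nrm_approx rr0 (ltW s0) nF' Bs m).
    apply: nrm_le_r; apply/andP; split; lra.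
  by move=> t /wP[].
exists w; split.
- exact: power_rep_analytic wrep.
- rewrite (power_rep0 wrep) /solution; exact: approx0.
- apply/nbhs_ballP; exists (r / 2) => /=; first by rewrite divr_gt0.
  by move=> t; rewrite /ball /= distrC => /ltW /wP[].
Qed.

Definition sroot p x := p.[x] = 0 /\ p^`().[x] != 0.

(** Expanding [q t] around [y0] and dividing by the derivative at the simple
root turns the equation into a fixed point equation without constant or linear
term at the centre. *)
Lemma simple_root_analytic (q : R -> {poly R}) D t0 y0 :
  (forall t, (size (q t) <= D)%N) ->
  (forall j, real_analytic_at (fun t => (q t)`_j) t0) -> sroot (q t0) y0 ->
  exists eta, [/\ real_analytic_at eta t0, eta t0 = y0 &
    \forall t \near t0, (q t).[eta t] = 0].
Proof.
move=> qD qa [qy qy'].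
pose u t := q t \Po ('X + y0%:P).
have uE t : u t = \sum_(l < D) (q t)`_l *: ('X + y0%:P) ^+ l.
  rewrite /u comp_polyE (big_ord_widen D (fun i => (q t)`_i *: ('X + y0%:P) ^+ i)) //.
  rewrite big_mkcond /=; apply: eq_bigr => i _; case: ltnP => // qi.
  by rewrite nth_default // scale0r.
have ua j : real_analytic_at (fun t => (u t)`_j) t0.
  under eq_fun do rewrite uE coef_sum.
  apply: analytic_sum => l; under eq_fun do rewrite coefZ.
  by apply: analytic_mul => //; exact: analytic_cst.
have uD t : (size (u t) <= D.+2)%N.
  rewrite uE; apply: leq_trans (size_sum _ _ _) _; apply/bigmax_leqP => l _.
  apply: leq_trans (size_scale_leq _ _) _.
  have -> : 'X + y0%:P = 'X - (- y0)%:P by rewrite polyCN opprK.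
  by rewrite size_exp_XsubC; case: l => l /= lD; rewrite (leq_trans lD) // leqW.
have u0 : (u t0)`_0 = 0 by rewrite -horner_coef0 horner_comp !hornerE ?add0r.
pose a := (u t0)`_1.
have a0 : a != 0.
  have -> : a = (u t0)^`().[0] by rewrite horner_coef0 coef_deriv mulr1n.
  by rewrite deriv_comp derivD derivX derivC addr0 mulr1 horner_comp !hornerE ?add0r.
pose g j t := (j == 1)%:R - a^-1 * (u t)`_j.
have [|||w [wa w0 wE]] := @fixpoint_analytic D g t0.
- move=> j; apply: analytic_add; first exact: analytic_cst.
  under eq_fun do rewrite -mulNr; apply: analytic_mul => //; exact: analytic_cst.
- by rewrite /g u0 mulr0 subr0.
- by rewrite /g -/a mulVf // subrr.
exists (fun t => w t + y0); split.
- by apply: analytic_add => //; exact: analytic_cst.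
- by rewrite w0 add0r.
- near=> t; have : w t = \sum_(j < D.+2) g j t * w t ^+ j by near: t.
  have -> : \sum_(j < D.+2) g j t * w t ^+ j = w t - a^-1 * (u t).[w t].
    rewrite (horner_coef_wide _ (uD t)) mulr_sumr.
    under eq_bigr do rewrite /g mulrBl -mulrA.
    rewrite sumrB; congr (_ - _).
    by rewrite 2!big_ord_recl /= mul0r add0r mul1r expr1 big1 ?addr0 // => i _; rewrite mul0r.
  move=> /eqP; rewrite -subr_eq0 opprB addrC subrK mulf_eq0 invr_eq0 (negPf a0) /=.
  by rewrite /u horner_comp !hornerE => /eqP.
Unshelve. all: by end_near.
Qed.

Lemma horner_analytic (q : R -> {poly R}) D t0 eta :
  (forall t, (size (q t) <= D)%N) ->
  (forall j, real_analytic_at (fun t => (q t)`_j) t0) ->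
  real_analytic_at eta t0 -> real_analytic_at (fun t => (q t).[eta t]) t0.
Proof.
move=> qD qa ea; under eq_fun do rewrite (horner_coef_wide _ (qD _)).
by apply: analytic_sum => i; apply: analytic_mul => //; exact: analytic_exp.
Qed.

(** The last clause fixes the number of simple roots, which is what identifies
each of them when the polynomial varies. *)
Definition lists_sroots p k (v : 'I_k -> R) :=
  [/\ forall j, sroot p (v j), forall i j : 'I_k, (i < j)%N -> v i < v j &
      forall z, sroot p z -> exists j, z = v j].

Lemma lists_sroots_unique p k (v w : 'I_k -> R) : lists_sroots p v ->
  (forall j, sroot p (w j)) -> (forall i j : 'I_k, (i < j)%N -> w i < w j) -> w =1 v.
Proof.
move=> [vr vlt vall] wr wlt.
have sorted_enum (f : 'I_k -> R) : (forall i j : 'I_k, (i < j)%N -> f i < f j) ->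
    sorted <%R [seq f j | j <- enum 'I_k].
  move=> flt; have : sorted ltn [seq val i | i <- enum 'I_k].
    by rewrite val_enum_ord iota_ltn_sorted.
  by rewrite !sorted_map; apply: sub_sorted => i j /flt.
have sw := sorted_enum w wlt; have sv := sorted_enum v vlt.
have wv : {subset [seq w j | j <- enum 'I_k] <= [seq v j | j <- enum 'I_k]}.
  move=> _ /mapP[j _ ->]; have [i ->] := vall _ (wr j).
  by apply/map_f; rewrite mem_enum.
have sz : (size [seq v j | j <- enum 'I_k] <= size [seq w j | j <- enum 'I_k])%N.
  by rewrite !size_map.
have [_ memE] := uniq_min_size (lt_sorted_uniq sw) wv sz.
have E : [seq w j | j <- enum 'I_k] = [seq v j | j <- enum 'I_k].
  exact: lt_sorted_eq.
by move=> j; move/eq_in_map: E; apply; rewrite mem_enum.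
Qed.

(** Where the number of simple roots is locally constant, each of them moves
analytically: the germs given by the implicit function theorem stay ordered,
so that counting identifies them with the listed roots. *)
Lemma lists_sroots_analytic (q : R -> {poly R}) D t0 k (v : R -> 'I_k -> R) i :
  (forall t, (size (q t) <= D)%N) ->
  (forall j, real_analytic_at (fun t => (q t)`_j) t0) ->
  (\forall t \near t0, lists_sroots (q t) (v t)) ->
  real_analytic_at (fun t => v t i) t0.
Proof.
move=> qD qa vq.
have [vr vlt vall] : lists_sroots (q t0) (v t0) := nbhs_singleton vq.
have /choice[eta Heta] : forall j, exists eta, [/\ real_analytic_at eta t0, eta t0 = v t0 j &
    \forall t \near t0, (q t).[eta t] = 0].
  by move=> j; apply: simple_root_analytic (vr j).
have ea j : real_analytic_at (eta j) t0 by have [] := Heta j.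
have e0 j : eta j t0 = v t0 j by have [] := Heta j.
have er : \forall t \near t0, forall j, (q t).[eta j t] = 0.
  apply: (@filter_forall _ _ (fun j t => (q t).[eta j t] = 0) (nbhs t0)) => j.
  by have [] := Heta j.
have er' : \forall t \near t0, forall j, (q t)^`().[eta j t] != 0.
  apply: (@filter_forall _ _ (fun j t => is_true ((q t)^`().[eta j t] != 0)) (nbhs t0)) => j.
  have /analytic_continuous : real_analytic_at (fun t => (q t)^`().[eta j t]) t0.
    apply: (@horner_analytic _ D) => // [t|l].
      apply: leq_trans (size_poly _ _) _; exact: leq_trans (leq_pred _) (qD t).
    under eq_fun do rewrite coef_deriv -mulr_natr.
    by apply: analytic_mul => //; exact: analytic_cst.
  by move=> /cvgr_neq0; apply; rewrite e0; have [] := vr j.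
have elt : \forall t \near t0, forall j l : 'I_k, (j < l)%N -> eta j t < eta l t.
  apply: (@filter_forall _ 'I_k (fun j t => forall l : 'I_k, (j < l)%N ->
    eta j t < eta l t) (nbhs t0)) => j.
  apply: (@filter_forall _ 'I_k (fun l t => (j < l)%N -> eta j t < eta l t) (nbhs t0)) => l.
  have [jl|] := boolP (j < l)%N; last by move=> _; near=> t.
  have /analytic_continuous : real_analytic_at (fun t => eta l t + -1 * eta j t) t0.
    apply: analytic_add => //; apply: analytic_mul => //; exact: analytic_cst.
  rewrite mulN1r !e0 => /cvgr_gt /(_ 0); rewrite subr_gt0 => /(_ (vlt _ _ jl)).
  by apply: filterS => t; rewrite mulN1r subr_gt0.
apply: analytic_near (ea i); near=> t.
apply: (@lists_sroots_unique (q t) k (v t) (fun j => eta j t)).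
- by near: t.
- have Er : forall j, (q t).[eta j t] = 0 by near: t.
  have Er' : forall j, (q t)^`().[eta j t] != 0 by near: t.
  by move=> j; split.
- by near: t.
Unshelve. all: by end_near.
Qed.

(** The inverse of [g] is the simple root of [g(t) X - 1]. *)
Lemma analytic_inv g t0 : real_analytic_at g t0 -> g t0 != 0 ->
  real_analytic_at (fun t => (g t)^-1) t0.
Proof.
move=> ga g0; pose q t := g t *: 'X - 1 : {poly R}.
have [t|j||eta [ea _ er]] := @simple_root_analytic q 2 t0 (g t0)^-1.
- apply: leq_trans (size_polyD _ _) _.
  by rewrite geq_max size_polyN size_poly1 andbT (leq_trans (size_scale_leq _ _)) ?size_polyX.
- rewrite /q; under eq_fun do rewrite coefB coefZ.
  apply: analytic_add; last exact: analytic_cst.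
  by apply: analytic_mul => //; exact: analytic_cst.
- by rewrite /q /sroot derivB derivZ derivX derivC !hornerE mulfV // subrr subr0.
- apply: analytic_near ea; near=> t.
  have : (q t).[eta t] = 0 by near: t.
  rewrite /q !hornerE => /eqP; rewrite subr_eq0 => /eqP E.
  have gn : g t != 0 by apply/eqP => gn; move/eqP: E; rewrite gn mul0r eq_sym oner_eq0.
  by rewrite -(mulKf gn (eta t)) E mulr1.
Unshelve. all: by end_near.
Qed.

End ImplicitFunction.

(** * Semialgebraic arc-analytic maps and images of cubes *)

Section Cells.
Variable R : realType.

Lemma polyfun_analytic n (f : 'rV[R]_n -> R) (gamma : R -> 'rV[R]_n) t0 :
  polyfun f -> (forall i, real_analytic_at (fun t => gamma t ord0 i) t0) ->
  real_analytic_at (fun t => f (gamma t)) t0.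
Proof.
move=> pf ga; elim: pf => {f} [a|i|f g _ IHf _ IHg|f g _ IHf _ IHg].
- exact: analytic_cst.
- have [Hi|Hi] := ltnP i n; last first.
    by rewrite nth_default ?size_coords_rV //; exact: analytic_cst.
  rewrite coords_rVE (nth_map (Ordinal Hi)) ?size_enum_ord //; exact: ga.
- exact: analytic_add.
- exact: analytic_mul.
Qed.

(** Analyticity in several variables is replaced by analyticity along arcs,
which is preserved by composition and is all that arc-symmetric sets detect. *)
Definition nash_map m n (D : set 'rV[R]_m) (phi : 'rV[R]_m -> 'rV[R]_n) :=
  sa (fun p : 'rV[R]_m * 'rV[R]_n => D p.1 /\ p.2 = phi p.1) /\
  forall gamma, analytic_arc D gamma ->
    forall i, real_analytic_on `]-1, 1[ (fun t => phi (gamma t) ord0 i).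

Definition nash_fun n (D : set 'rV[R]_n) (s : 'rV[R]_n -> R) :=
  sa (fun p : 'rV[R]_n * R => D p.1 /\ p.2 = s p.1) /\
  forall gamma, analytic_arc D gamma ->
    real_analytic_on `]-1, 1[ (fun t => s (gamma t)).

Lemma analytic_arc_sub n (D D' : set 'rV[R]_n) gamma : D `<=` D' ->
  analytic_arc D gamma -> analytic_arc D' gamma.
Proof. by move=> DD' [gD ga]; split=> // t /gD /DD'. Qed.

Lemma nash_arc m n (D : set 'rV[R]_m) (E : set 'rV[R]_n) phi gamma :
  nash_map D phi -> (forall x, D x -> E (phi x)) -> analytic_arc D gamma ->
  analytic_arc E (phi \o gamma).
Proof. by move=> [_ pa] DE ga; split=> [t /ga.1 /DE //|i]; exact: pa. Qed.

Lemma polymap_fst_snd (T U V : Type) (c : Coords R T) (d : Coords R U) (e : Coords R V) :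
  [/\ @polymap R (T * U * V) T _ _ (fun p => p.1.1),
      @polymap R (T * U * V) U _ _ (fun p => p.1.2) &
      @polymap R (T * U * V) V _ _ snd].
Proof.
by split; [apply: (polymap_comp polymap_fst polymap_fst)
  |apply: (polymap_comp polymap_fst polymap_snd)|exact: polymap_snd].
Qed.

Lemma nash_map_preimage m n (D : set 'rV[R]_m) (C : set 'rV[R]_n) phi :
  nash_map D phi -> sa C -> sa (fun x => D x /\ C (phi x)).
Proof.
move=> [sg _] sC.
apply: (@sa_ext _ _ _ (fun x => exists y, (D x /\ y = phi x) /\ C y)).
  by move=> x; split=> [[y [[Dx ->]]]|[Dx Cx]] //; exists (phi x).
apply: sa_ex_rV; apply: sa_and; first exact: sg.
exact: (sa_subst sC polymap_snd).
Qed.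

Lemma nash_map_image m n (D : set 'rV[R]_m) (phi : 'rV[R]_m -> 'rV[R]_n) :
  nash_map D phi -> sa (phi @` D).
Proof.
move=> [sg _]; apply: (@sa_ext _ _ _ (fun y => exists x, D x /\ y = phi x)).
  by move=> y; split=> [[x [Dx ->]]|[x Dx <-]]; exists x.
apply: sa_ex_rV; apply: (sa_subst (h := fun p => (p.2, p.1)) sg).
by apply: polymap_pair; [exact: polymap_snd|exact: polymap_fst].
Qed.

Lemma nash_map_restrict m n (D D' : set 'rV[R]_m) (phi : 'rV[R]_m -> 'rV[R]_n) :
  nash_map D phi -> sa D' -> D' `<=` D -> nash_map D' phi.
Proof.
move=> [sg pa] sD' DD'; split; last first.
  by move=> gamma /(analytic_arc_sub DD') ga i; exact: pa.
apply: (@sa_ext _ _ _ (fun p => (D p.1 /\ p.2 = phi p.1) /\ D' p.1)).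
  by move=> p; split=> [[[]]|[D'p ->]] //; do !split; auto.
apply: sa_and => //; exact: (sa_subst sD' polymap_fst).
Qed.

Lemma nash_map_comp l m n (D : set 'rV[R]_l) (E : set 'rV[R]_m)
    (phi : 'rV[R]_l -> 'rV[R]_m) (psi : 'rV[R]_m -> 'rV[R]_n) :
  nash_map D phi -> nash_map E psi -> (forall x, D x -> E (phi x)) ->
  nash_map D (psi \o phi).
Proof.
move=> Hphi [sE pE] DE; split; last first.
  move=> gamma ga i; exact: (pE _ (nash_arc Hphi DE ga)).
have [sD _] := Hphi.
apply: (@sa_ext _ _ _ (fun p => exists y, (D p.1 /\ y = phi p.1) /\ (E y /\ p.2 = psi y))).
  move=> p; split=> [[y [[Dp ->] [_ ->]]]|[Dp ->]] //.
  by exists (phi p.1); do !split => //; exact: DE.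
have [p1 p2 p3] := polymap_fst_snd (coords_rV R l) (coords_rV R n) (coords_rV R m).
apply: sa_ex_rV; apply: sa_and.
  exact: (sa_subst (h := fun q => (q.1.1, q.2)) sD (polymap_pair p1 p3)).
exact: (sa_subst (h := fun q => (q.2, q.1.2)) sE (polymap_pair p3 p2)).
Qed.

Lemma sa_eq_rV T (c : Coords R T) n (h k : T -> 'rV[R]_n) :
  polymap h -> polymap k -> sa (fun t => h t = k t).
Proof.
move=> ph pk; apply: (@sa_ext _ _ _ (fun t => forall i, h t ord0 i = k t ord0 i)).
  by move=> t; split=> [H|-> //]; apply/rowP.
by apply: sa_all_fin => i; apply: sa_eq; exact: polymap_entry.
Qed.

Lemma nash_map_poly m n (D : set 'rV[R]_m) (phi : 'rV[R]_m -> 'rV[R]_n) :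
  sa D -> polymap phi -> nash_map D phi.
Proof.
move=> sD pp; split.
  apply: sa_and; first exact: (sa_subst sD polymap_fst).
  apply: sa_eq_rV; first exact: polymap_snd.
  exact: (polymap_comp polymap_fst pp).
move=> gamma [_ ga] i t t1; apply: (@polyfun_analytic _ (fun x => phi x ord0 i)).
  exact: polymap_entry.
by move=> j; exact: ga.
Qed.

Lemma row_mx1P n (z : 'rV[R]_(1 + n)) (y : R) (x : 'rV[R]_n) :
  z = row_mx y%:M x <-> lsubmx z ord0 ord0 = y /\ rsubmx z = x.
Proof.
split=> [->|[<- <-]]; first by rewrite row_mxKl row_mxKr mxE eqxx mulr1n.
by rewrite -mx11_scalar hsubmxK.
Qed.

Lemma row_mx1K n (z : 'rV[R]_(1 + n)) :
  row_mx (lsubmx z ord0 ord0)%:M (rsubmx z) = z.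
Proof. by rewrite -mx11_scalar hsubmxK. Qed.

Lemma row_mx1_entry0 n (y : R) (x : 'rV[R]_n) :
  lsubmx (row_mx y%:M x : 'rV[R]_(1 + n)) ord0 ord0 = y.
Proof. by rewrite row_mxKl mxE eqxx mulr1n. Qed.

Lemma nash_map_cons m n (D : set 'rV[R]_m) (s : 'rV[R]_m -> R)
    (phi : 'rV[R]_m -> 'rV[R]_n) :
  nash_fun D s -> nash_map D phi ->
  nash_map D (fun x => row_mx (s x)%:M (phi x) : 'rV[R]_(1 + n)).
Proof.
move=> [ss sna] [sg pa]; split; last first.
  move=> gamma ga i t t1; case: (split_ordP i) => j ->.
    apply: analytic_near (sna _ ga t t1); near=> u.
    by rewrite row_mxEl (ord1 j) mxE eqxx mulr1n.
  apply: analytic_near (pa _ ga j t t1); near=> u.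
  by rewrite row_mxEr.
apply: (@sa_ext _ _ _ (fun p => (D p.1 /\ lsubmx p.2 ord0 ord0 = s p.1) /\
    (D p.1 /\ rsubmx p.2 = phi p.1))).
  by move=> p; rewrite row_mx1P; tauto.
have p2 := @polymap_snd R _ _ (coords_rV R m) (coords_rV R (1 + n)).
have p1 := @polymap_fst R _ _ (coords_rV R m) (coords_rV R (1 + n)).
apply: sa_and.
  apply: (sa_subst (h := fun p => (p.1, lsubmx p.2 ord0 ord0)) ss).
  by apply: polymap_pair => //; apply/polymap_fun/polymap_entry/polymap_lsub.
apply: (sa_subst (h := fun p => (p.1, rsubmx p.2)) sg).
by apply: polymap_pair => //; exact: polymap_rsub.
Unshelve. all: by end_near.
Qed.

Definition cube n : set 'rV[R]_n := [set x | forall i, 0 < x ord0 i < 1].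

Lemma sa_itv T (c : Coords R T) (f : T -> R) : polyfun f ->
  sa (fun t => 0 < f t < 1).
Proof.
move=> pf; apply: (@sa_ext _ _ _ (fun t => 0 < f t /\ f t < 1)).
  by move=> t; apply: rwP; exact: andP.
by apply: sa_and; apply: sa_lt => //; exact: polyfun_cst.
Qed.

Lemma sa_cube n : sa (@cube n).
Proof. by apply: sa_all_fin => i; apply: sa_itv; exact: polyfun_entry. Qed.

Lemma cubeS n (x : 'rV[R]_(1 + n)) :
  cube x <-> (0 < lsubmx x ord0 ord0 < 1) /\ cube (rsubmx x).
Proof.
split=> [H|[H1 H2] i]; first by split=> [|i]; rewrite mxE; exact: H.
case: (split_ordP i) => j ->; first by rewrite (ord1 j); move: H1; rewrite mxE.
by have := H2 j; rewrite mxE.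
Qed.

(** The bound [m] on the dimensions of the cubes plays the part of a dimension
of the set. *)
Inductive covered n (m : nat) : set 'rV[R]_n -> Prop :=
| covered0 : covered m set0
| coveredU A B : covered m A -> covered m B -> covered m (A `|` B)
| covered_cell d (phi : 'rV[R]_d -> 'rV[R]_n) :
    (d < m)%N -> nash_map (@cube d) phi -> covered m (phi @` @cube d).

Lemma covered_sa n m (A : set 'rV[R]_n) : covered m A -> sa A.
Proof.
elim=> [|B C _ sB _ sC|d phi _ Hphi]; last exact: nash_map_image.
  by apply: sa_ext (sa_false _) => x; split.
by apply: sa_ext (sa_or sB sC) => x; split.
Qed.

Lemma covered_mono n m m' (A : set 'rV[R]_n) : (m <= m')%N ->
  covered m A -> covered m' A.
Proof.
move=> mm; elim=> [|B C _ sB _ sC|d phi dm Hphi].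
- exact: covered0.
- exact: coveredU.
- by apply: covered_cell => //; exact: leq_trans mm.
Qed.

Lemma covered_ex_seq n m (I : eqType) (s : seq I) (A : I -> set 'rV[R]_n) :
  (forall i, i \in s -> covered m (A i)) ->
  covered m [set x | exists2 i, i \in s & A i x].
Proof.
elim: s => [|i s IH] HA.
  by rewrite (_ : [set x | _] = set0); [exact: covered0|apply/seteqP; split=> x //= -[]].
have -> : [set x | exists2 j, j \in i :: s & A j x] =
    A i `|` [set x | exists2 j, j \in s & A j x].
  apply/seteqP; split=> x /=.
    by case=> j; rewrite inE => /predU1P[->|js] Aj; [left|right; exists j].
  by case=> [Ai|[j js Aj]]; [exists i|exists j]; rewrite // inE ?eqxx ?js ?orbT.
apply: coveredU; first by apply: HA; rewrite inE eqxx.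
by apply: IH => j js; apply: HA; rewrite inE js orbT.
Qed.

Lemma covered_ex_fin n m (I : finType) (A : I -> set 'rV[R]_n) :
  (forall i, covered m (A i)) -> covered m [set x | exists i, A i x].
Proof.
move=> HA; have := @covered_ex_seq n m I (enum I) A (fun i _ => HA i).
by congr covered; apply/seteqP; split=> x [i] => [_|] Ai; exists i; rewrite ?mem_enum.
Qed.

Lemma covered_image k n m (A : set 'rV[R]_k) (psi : 'rV[R]_k -> 'rV[R]_n) :
  covered m A -> nash_map A psi -> covered m (psi @` A).
Proof.
elim=> [|B C cB IHB cC IHC|d phi dm Hphi] Hpsi.
- by rewrite image_set0; exact: covered0.
- rewrite image_setU; apply: coveredU.
    by apply: IHB; apply: nash_map_restrict Hpsi (covered_sa cB) _; exact: subsetUl.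
  by apply: IHC; apply: nash_map_restrict Hpsi (covered_sa cC) _; exact: subsetUr.
- rewrite image_comp; apply: covered_cell => //.
  by apply: nash_map_comp Hphi Hpsi _ => x cx; exists x.
Qed.

Lemma covered_prod n m (A : set 'rV[R]_n) : covered m A ->
  covered m.+1 [set z : 'rV[R]_(1 + n) | 0 < lsubmx z ord0 ord0 < 1 /\ A (rsubmx z)].
Proof.
elim=> [|B C cB IHB cC IHC|d phi dm Hphi].
- by rewrite (_ : [set z | _] = set0); [exact: covered0|apply/seteqP; split=> x //= -[]].
- have := coveredU IHB IHC; congr covered; apply/seteqP; split=> z /=; tauto.
pose h (x : 'rV[R]_(1 + d)) : 'rV[R]_(1 + n) :=
  row_mx (lsubmx x ord0 ord0)%:M (phi (rsubmx x)).
have -> : [set z : 'rV[R]_(1 + n) | 0 < lsubmx z ord0 ord0 < 1 /\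
    (phi @` @cube d) (rsubmx z)] = h @` @cube (1 + d).
  apply/seteqP; split=> z /=.
    move=> [z0 [x cx xz]]; exists (row_mx (lsubmx z ord0 ord0)%:M x).
      by apply/cubeS; rewrite row_mx1_entry0 row_mxKr.
    by rewrite /h row_mx1_entry0 row_mxKr xz row_mx1K.
  move=> [x /cubeS[x0 cx] <-]; rewrite /h row_mx1_entry0 row_mxKr.
  by split => //; exists (rsubmx x).
have rs : nash_map (@cube (1 + d)) (@rsubmx R 1 1 d).
  apply: nash_map_poly; first exact: sa_cube.
  by apply: polymap_rsub; exact: polymap_id.
apply: covered_cell => //; apply: nash_map_cons; last first.
  by apply: nash_map_comp rs Hphi _ => x /cubeS[].
have pl := polymap_entry ord0 (polymap_lsub (@polymap_id R _ (coords_rV R (1 + d)))).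
split.
  apply: sa_and; first exact: (sa_subst (sa_cube _) polymap_fst).
  apply: sa_eq; first exact/polyfun_of_map/polymap_snd.
  exact: (polymap_fst _ pl).
by move=> gamma [_ ga] t t1; apply: (polyfun_analytic pl) => i; exact: ga.
Qed.

End Cells.

(** * Cylindrical decomposition *)

Section Decomposition.
Variable R : realType.
Implicit Types (p q : {poly R}) (y z : R).

(** Differentiation lowers the multiplicity of a root by one. *)
Lemma root_sroot p y : p != 0 -> root p y ->
  exists2 j, (j < size p)%N & sroot p^`(j) y.
Proof.
move: {2}(size p) (leqnn (size p)) => n; elim: n p => [|n IH] p.
  by rewrite leqn0 size_poly_eq0 => /eqP ->; rewrite eqxx.
move=> pn p0 py.
have [py'|py'] := boolP (root p^`() y); last first.
  exists 0%N; first by rewrite lt0n size_poly_eq0.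
  by rewrite derivn0; split; [exact/eqP|].
have sp' : (size p^`()%R < size p)%N by rewrite lt_size_deriv.
have p'0 : p^`()%R != 0.
  have s1 := root_size_gt1 p0 py.
  apply: contraNneq p0 => p'0; rewrite -lead_coef_eq0 lead_coefE.
  have := coef_deriv p (size p).-2; rewrite p'0 coef0.
  by case: (size p) s1 => [|[|k]] // _ /esym/eqP; rewrite mulrn_eq0.
have [j jp Hj] := IH _ (leq_trans sp' pn : (size p^`()%R < n.+1)%N) p'0 py'.
exists j.+1; first exact: leq_ltn_trans jp sp'.
by rewrite derivSn.
Qed.

(** Here [a] and [b] are the nearest roots around [y] of the product of the
nonzero members of [L]; the members ['X] and ['X - 1] ensure that they exist,
and closure under derivation that they are simple roots of members. *)
Lemma bracket (L : seq {poly R}) y :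
  (forall p z, p \in L -> p != 0 -> root p z -> exists2 q, q \in L & sroot q z) ->
  'X \in L -> 'X - 1 \in L -> 0 < y < 1 -> (forall p, p \in L -> ~ sroot p y) ->
  exists a b p q, [/\ p \in L, q \in L, sroot p a, sroot q b & a < y < b] /\
    forall r, r \in L -> r != 0 -> {in `]a, b[, forall z, ~~ root r z}.
Proof.
move=> Lclosed XL X1L /andP[y0 y1] Ly.
pose G := \prod_(p <- L | p != 0) p.
have G0 : G != 0 by rewrite prodf_seq_neq0; apply/allP => p _; apply/implyP.
have rootG z : reflect (exists2 p, p \in L & p != 0 /\ root p z) (root G z).
  rewrite /root horner_prod prodf_seq_eq0; apply: (iffP hasP).
    by case=> p pL /andP[p0 pz]; exists p.
  by case=> p pL [p0 pz]; exists p => //; rewrite p0.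
have rG0 : root G 0 by apply/rootG; exists 'X => //; rewrite polyX_eq0 rootX.
have rG1 : root G 1.
  apply/rootG; exists ('X - 1) => //; rewrite polyXsubC_eq0; split => //.
  by rewrite root_XsubC.
have nGy : ~~ root G y.
  apply/rootG => -[p pL [p0 py]]; have [q qL qy] := Lclosed _ _ pL p0 py.
  exact: Ly qL qy.
have [a [ay Ga noa]] : exists a, [/\ a < y, root G a & {in `]a, y[, forall z, ~~ root G z}].
  case: (prev_rootP G 0 y) => [G00|a _ Ga ain noa|_ _ _ noa].
  - by rewrite G00 eqxx in G0.
  - by exists a; split => //; [rewrite (itvP ain)|exact/eqP].
  - by exists 0.
have [b [yb Gb nob]] : exists b, [/\ y < b, root G b & {in `]y, b[, forall z, ~~ root G z}].
  case: (next_rootP G y 1) => [G00|b _ Gb bin nob|_ _ _ nob].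
  - by rewrite G00 eqxx in G0.
  - by exists b; split => //; [rewrite (itvP bin)|exact/eqP].
  - by exists 1.
have [p1 p1L [p10 p1a]] := rootG _ Ga; have [p pL pa] := Lclosed _ _ p1L p10 p1a.
have [q1 q1L [q10 q1b]] := rootG _ Gb; have [q qL qb] := Lclosed _ _ q1L q10 q1b.
exists a, b, p, q; split; first by split => //; rewrite ay.
move=> r rL r0 z; rewrite in_itv /= => /andP[az zb]; apply/negP => rz.
have Gz : root G z by apply/rootG; exists r.
case: (ltgtP z y) => zy.
- by have := noa z; rewrite in_itv /= az zy Gz => /(_ isT).
- by have := nob z; rewrite in_itv /= zb zy Gz => /(_ isT).
- by move: nGy; rewrite -zy Gz.
Qed.

Lemma lists_sroots_exists p : exists2 k, (k <= size p)%N &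
  exists v : 'rV[R]_k, lists_sroots p (v ord0).
Proof.
pose s := [seq z <- rootsR p | p^`()%R.[z] != 0].
have sP z : z \in s <-> sroot p z.
  rewrite mem_filter; have [->|p0] := eqVneq p 0.
    by rewrite rootsR0 /sroot deriv0 horner0 eqxx andbF; split=> // -[].
  rewrite -(roots_on_rootsR p0) /= /sroot.
  by split=> [/andP[? /eqP]|[/eqP ? ->]].
have ss : sorted <%R s.
  by apply: sorted_filter; [exact: lt_trans|exact: sorted_roots].
exists (size s).
  have [p00|p0] := eqVneq p 0; first by rewrite /s p00 rootsR0.
  apply/ltnW/max_poly_roots => //; last exact: lt_sorted_uniq.
  by apply/allP => z /sP[/eqP].
exists (\row_j nth 0 s j); split.
- by move=> j; rewrite mxE; apply/sP; exact: mem_nth.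
- by move=> i j ij; rewrite !mxE; apply: (sorted_ltn_nth lt_trans) => //; rewrite inE.
- move=> z /sP zs; have zi : (index z s < size s)%N by rewrite index_mem.
  by exists (Ordinal zi); rewrite mxE nth_index.
Qed.

(** The uniform bound on the sizes makes evaluation a polynomial function and
the number of roots bounded. *)
Definition poly_family T (c : Coords R T) (q : T -> {poly R}) :=
  (forall j, polyfun (fun t => (q t)`_j)) /\ exists D, forall t, (size (q t) <= D)%N.
Arguments poly_family {T c}.

Lemma poly_family_subst T U (c : Coords R T) (d : Coords R U) (q : U -> {poly R})
  (h : T -> U) : poly_family q -> polymap h -> poly_family (fun t => q (h t)).
Proof.
by move=> [qc [D qD]] ph; split=> [j|]; [exact: (ph _ (qc j))|exists D].
Qed.

Lemma poly_family_cst T (c : Coords R T) (p : {poly R}) : poly_family (fun=> p : {poly R}).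
Proof. by split=> [j|]; [exact: polyfun_cst|exists (size p)]. Qed.

Lemma poly_familyC T (c : Coords R T) (f : T -> R) :
  polyfun f -> poly_family (fun t => (f t)%:P).
Proof.
move=> pf; split=> [[|j]|]; last by exists 1%N => t; exact: size_polyC_leq1.
  by under eq_fun do rewrite coefC.
by under eq_fun do rewrite coefC; exact: polyfun_cst.
Qed.

Lemma poly_familyD T (c : Coords R T) (p q : T -> {poly R}) :
  poly_family p -> poly_family q -> poly_family (fun t => p t + q t).
Proof.
move=> [pc [D pD]] [qc [E qE]]; split=> [j|].
  by under eq_fun do rewrite coefD; exact: polyfun_add.
exists (maxn D E) => t; apply: leq_trans (size_polyD _ _) _.
by rewrite geq_max !leq_max pD qE orbT.
Qed.

Lemma poly_familyM T (c : Coords R T) (p q : T -> {poly R}) :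
  poly_family p -> poly_family q -> poly_family (fun t => p t * q t).
Proof.
move=> [pc [D pD]] [qc [E qE]]; split=> [j|].
  under eq_fun do rewrite coefM.
  by apply: polyfun_sum => i; exact: polyfun_mul.
exists (D + E)%N => t; apply: leq_trans (size_polyMleq _ _) _.
by apply: leq_trans (leq_pred _) _; exact: leq_add.
Qed.

Lemma poly_family_deriv T (c : Coords R T) (p : T -> {poly R}) :
  poly_family p -> poly_family (fun t => (p t)^`()%R).
Proof.
move=> [pc [D pD]]; split=> [j|].
  under eq_fun do rewrite coef_deriv -mulr_natr.
  by apply: polyfun_mul => //; exact: polyfun_cst.
exists D => t; apply: leq_trans (size_poly _ _) _; exact: leq_trans (leq_pred _) (pD t).
Qed.

Lemma poly_family_derivn T (c : Coords R T) (p : T -> {poly R}) n :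
  poly_family p -> poly_family (fun t => (p t)^`(n)%R).
Proof.
by move=> fp; elim: n => [//|n IH]; under eq_fun do rewrite derivnS; exact: poly_family_deriv.
Qed.

Lemma polyfun_horner T (c : Coords R T) (q : T -> {poly R}) (y : T -> R) :
  poly_family q -> polyfun y -> polyfun (fun t => (q t).[y t]).
Proof.
move=> [qc [D qD]] py; under eq_fun do rewrite (horner_coef_wide _ (qD _)).
by apply: polyfun_sum => i; apply: polyfun_mul => //; exact: polyfun_exp.
Qed.

Lemma sa_sroot T (c : Coords R T) (q : T -> {poly R}) (y : T -> R) :
  poly_family q -> polyfun y -> sa (fun t => sroot (q t) (y t)).
Proof.
move=> fq py; apply: sa_and.
  by apply: sa_eq; [exact: polyfun_horner|exact: polyfun_cst].
apply: (@sa_ext _ _ _ (fun t => ~ ((q t)^`()%R.[y t] = 0))).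
  by move=> t; split=> /eqP.
apply/sa_not/sa_eq; last exact: polyfun_cst.
by apply: polyfun_horner => //; exact: poly_family_deriv.
Qed.

Lemma sa_lists_sroots T (c : Coords R T) k (q : T -> {poly R}) (v : T -> 'rV[R]_k) :
  poly_family q -> polymap v -> sa (fun t => lists_sroots (q t) (v t ord0)).
Proof.
move=> fq pv.
apply: (@sa_ext _ _ _ (fun t => (forall j, sroot (q t) (v t ord0 j)) /\
   ((forall i j : 'I_k, (i < j)%N -> v t ord0 i < v t ord0 j) /\
   forall z, sroot (q t) z -> exists j, z = v t ord0 j))).
  by move=> t; split=> [[? []]|[]].
apply: sa_and; last apply: sa_and.
- by apply: sa_all_fin => j; apply: sa_sroot => //; exact: polymap_entry.
- apply: sa_all_fin => i; apply: sa_all_fin => j.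
  have [ij|ij] := boolP (i < j)%N.
    apply: (@sa_ext _ _ _ (fun t => v t ord0 i < v t ord0 j)).
      by move=> t; split=> // /(_ isT).
    by apply: sa_lt; exact: polymap_entry.
  by apply: sa_ext (sa_true c) => t; split.
- apply: sa_all; apply: sa_imp.
    apply: sa_sroot; last exact/polyfun_of_map/polymap_snd.
    exact: (poly_family_subst fq polymap_fst).
  apply: sa_ex_fin => j; apply: sa_eq; first exact/polyfun_of_map/polymap_snd.
  exact: (polymap_entry j (polymap_comp polymap_fst pv)).
Qed.

Lemma polyfun_split n (f : 'rV[R]_(1 + n) -> R) : polyfun f ->
  exists2 q : 'rV[R]_n -> {poly R}, poly_family q &
    forall y x, f (row_mx y%:M x) = (q x).[y].
Proof.
elim=> {f} [a|i|f g _ [p fp pE] _ [q fq qE]|f g _ [p fp pE] _ [q fq qE]].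
- exists (fun=> a%:P); first exact: poly_family_cst.
  by move=> y x; rewrite hornerC.
- have [Hi|Hi] := ltnP i (1 + n); last first.
    exists (fun=> 0); first exact: poly_family_cst.
    by move=> y x; rewrite horner0 nth_default // size_coords_rV.
  have -> : nth (fun=> 0) (coords R 'rV[R]_(1 + n)) i = fun x => x ord0 (Ordinal Hi).
    rewrite coords_rVE (nth_map (Ordinal Hi)) ?size_enum_ord //.
    by rewrite (nth_ord_enum (Ordinal Hi) (Ordinal Hi)).
  case: (split_ordP (Ordinal Hi)) => j ->.
    exists (fun=> 'X); first exact: poly_family_cst.
    by move=> y x; rewrite row_mxEl hornerX (ord1 j) mxE eqxx mulr1n.
  exists (fun x => (x ord0 j)%:P); first exact/poly_familyC/polyfun_entry.
  by move=> y x; rewrite row_mxEr hornerC.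
- exists (fun x => p x + q x); first exact: poly_familyD.
  by move=> y x; rewrite hornerD pE qE.
- exists (fun x => p x * q x); first exact: poly_familyM.
  by move=> y x; rewrite hornerM pE qE.
Qed.

(** A polynomial function of [1 + n] variables is a polynomial in the first one
whose coefficients are polynomial functions of the others. *)
Lemma sa_signs n (A : set 'rV[R]_(1 + n)) : sa A ->
  exists2 L : seq ('rV[R]_n -> {poly R}),
    forall q : 'rV[R]_n -> {poly R}, q \in L -> poly_family q &
    forall x y y', (forall q : 'rV[R]_n -> {poly R}, q \in L ->
      Num.sg (q x).[y] = Num.sg (q x).[y']) ->
    A (row_mx y%:M x) <-> A (row_mx y'%:M x).
Proof.
elim=> {A} [f /polyfun_split[q fq qE]|P _ [L fL HL]|P Q _ [L fL HL] _ [L' fL' HL']].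
- exists [:: q]; first by move=> p; rewrite inE => /eqP ->.
  move=> x y y' /(_ q (mem_head _ _)) E.
  by rewrite !qE -sgr_cp0 E sgr_cp0.
- by exists L => // x y y' /HL; tauto.
- exists (L ++ L') => [q|x y y' H]; first by rewrite mem_cat => /orP[/fL|/fL'].
  have H1 : forall q : 'rV[R]_n -> {poly R}, q \in L -> Num.sg (q x).[y] = Num.sg (q x).[y'].
    by move=> q qL; apply: H; rewrite mem_cat qL.
  have H2 : forall q : 'rV[R]_n -> {poly R}, q \in L' -> Num.sg (q x).[y] = Num.sg (q x).[y'].
    by move=> q qL; apply: H; rewrite mem_cat qL orbT.
  by have := HL x y y' H1; have := HL' x y y' H2; tauto.
Qed.

End Decomposition.
Arguments poly_family {R T c}.
Section CellDecomposition.
Variable R : realType.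

(** The value is meaningful where [q x] has exactly [k] simple roots, and is the
[i]-th of them there. *)
Definition root_sel n (q : 'rV[R]_n -> {poly R}) k (i : 'I_k) (x : 'rV[R]_n) : R :=
  (xget 0 [set v : 'rV[R]_k | lists_sroots (q x) (v ord0)]) ord0 i.

Lemma root_selP n (q : 'rV[R]_n -> {poly R}) k x :
  (exists v : 'rV[R]_k, lists_sroots (q x) (v ord0)) ->
  lists_sroots (q x) (fun i : 'I_k => root_sel q i x).
Proof.
move=> [v Hv].
exact: (@xgetPex _ (0 : 'rV[R]_k) [set w | lists_sroots (q x) (w ord0)] (ex_intro _ v Hv)).
Qed.

Lemma root_selE n (q : 'rV[R]_n -> {poly R}) k (i : 'I_k) x (v : 'rV[R]_k) :
  lists_sroots (q x) (v ord0) -> root_sel q i x = v ord0 i.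
Proof.
move=> Hv; have [r l _] : lists_sroots (q x) (fun i : 'I_k => root_sel q i x).
  by apply: root_selP; exists v.
exact: (lists_sroots_unique Hv r l).
Qed.

Lemma root_sel_nash n (D : set 'rV[R]_n) (q : 'rV[R]_n -> {poly R}) k (i : 'I_k) :
  sa D -> poly_family q ->
  (forall x, D x -> exists v : 'rV[R]_k, lists_sroots (q x) (v ord0)) ->
  nash_fun D (root_sel q i).
Proof.
move=> sD fq Dq; split.
  apply: (@sa_ext _ _ _ (fun p => exists v : 'rV[R]_k,
      (D p.1 /\ lists_sroots (q p.1) (v ord0)) /\ p.2 = v ord0 i)).
    move=> p; split=> [[v [[Dp Hv] ->]]|[Dp ->]]; first by rewrite (root_selE _ Hv).
    by have [v Hv] := Dq _ Dp; exists v; rewrite (root_selE _ Hv).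
  have [p1 p2 p3] := polymap_fst_snd (coords_rV R n) (coordsR R) (coords_rV R k).
  apply: sa_ex_rV; apply: sa_and; first apply: sa_and.
  - exact: (sa_subst sD p1).
  - exact: (sa_lists_sroots (poly_family_subst fq p1) p3).
  - by apply: sa_eq; [exact: polyfun_of_map|exact: polymap_entry].
move=> gamma [gD ga] t t1; have [qc [d qd]] := fq.
apply: (@lists_sroots_analytic _ (fun u => q (gamma u)) d t k
  (fun u j => root_sel q j (gamma u)) i) => [u|j|].
- exact: qd.
- by apply: (polyfun_analytic (qc j)) => l; exact: ga.
- have : \forall u \near t, u \in `]-1, 1[ by apply: near_in_itvoo.
  by apply: filterS => u u1; apply: root_selP; apply/Dq/gD.
Qed.

(** With all the derivatives adjoined, each root of a nonzero member is a
simple root of a member. *)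
Lemma derivative_closure n (L1 : seq ('rV[R]_n -> {poly R})) :
  (forall q : 'rV[R]_n -> {poly R}, q \in L1 -> poly_family q) ->
  exists N, exists L : seq ('rV[R]_n -> {poly R}),
  [/\ {subset L1 <= L},
      forall q : 'rV[R]_n -> {poly R}, q \in L -> poly_family q,
      forall (q : 'rV[R]_n -> {poly R}) x, q \in L -> (size (q x) <= N)%N &
      forall (q : 'rV[R]_n -> {poly R}) x z, q \in L -> q x != 0 -> root (q x) z ->
        exists2 r : 'rV[R]_n -> {poly R}, r \in L & sroot (r x) z].
Proof.
move=> fL1.
have [N HN] : exists N, forall (q : 'rV[R]_n -> {poly R}) x, q \in L1 -> (size (q x) <= N)%N.
  elim: L1 fL1 => [|q L IH] fL; first by exists 0%N.
  have [|N HN] := IH; first by move=> r rL; apply: fL; rewrite inE rL orbT.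
  have [_ [D qD]] := fL q (mem_head _ _).
  exists (maxn D N) => r x; rewrite inE leq_max => /predU1P[->|rL].
    by rewrite qD.
  by rewrite HN ?orbT.
exists N, [seq (fun x => (q x)^`(j)%R) | q <- L1, j <- iota 0 N.+1].
have HL r : r \in [seq (fun x => (q x)^`(j)%R) | q <- L1, j <- iota 0 N.+1] ->
    exists q j, [/\ q \in L1, (j <= N)%N & r = fun x => (q x)^`(j)%R].
  by move=> /allpairsP[[q j] [qL + ->]]; rewrite mem_iota => jN; exists q, j.
split.
- move=> q qL; apply/allpairsP; exists (q, 0%N); split => //=.
- by move=> _ /HL[q [j [qL _ ->]]]; apply: poly_family_derivn; exact: fL1.
- move=> _ x /HL[q [j [qL _ ->]]]; apply: leq_trans (HN q x qL).
  elim: j => [|j IH]; first by rewrite derivn0.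
  rewrite derivnS; apply: leq_trans (size_poly _ _) _.
  exact: leq_trans (leq_pred _) IH.
move=> _ x z /HL[q [j [qL _ ->]]] q0 qz.
have [i _ Hi] := root_sroot q0 qz; have Hij : sroot (q x)^`(i + j)%R z.
  move: Hi; rewrite /sroot; suff -> : ((q x)^`(j))^`(i)%R = (q x)^`(i + j)%R by [].
  by rewrite /derivn iterD.
exists (fun x => (q x)^`(i + j)%R) => //; apply/allpairsP; exists (q, (i + j)%N).
split => //; rewrite mem_iota add0n leq0n /= ltnS leqNgt; apply/negP => Nij.
move: Hij => [_]; rewrite derivn_poly0 ?deriv0 ?horner0 ?eqxx //.
by apply: leq_trans (HN q x qL) _; exact: ltnW.
Qed.

Lemma cube_row n (y : R) (x : 'rV[R]_n) :
  cube (row_mx y%:M x : 'rV[R]_(1 + n)) <-> 0 < y < 1 /\ cube x.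
Proof. by rewrite cubeS row_mx1_entry0 row_mxKr. Qed.

Section Cells.
Variables (n m : nat) (A : set 'rV[R]_(1 + n)).
Hypotheses (sA : sa A) (Acube : A `<=` @cube R (1 + n)).
(* [H1] is for the bases of graphs; [H2], for those of bands, asks for one
dimension less, as a band has one dimension more than its base. *)
Hypothesis H1 : forall B : set 'rV[R]_n, sa B -> B `<=` @cube R n -> covered m.+1 B.
Hypothesis H2 : forall B : set 'rV[R]_n, sa B -> B `<=` @cube R n ->
  (forall x, B x -> exists a b, a < b /\ forall y, a < y < b -> A (row_mx y%:M x)) ->
  covered m B.

(** The cell is the graph of a root function over the set of [x] at which this
root exists and its point lies in [A]; the graph map is arc-analytic. *)
Lemma graph_cell_covered (q : 'rV[R]_n -> {poly R}) k (i : 'I_k) : poly_family q ->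
  covered m.+1 [set z : 'rV[R]_(1 + n) | A z /\ exists v : 'rV[R]_k,
    lists_sroots (q (rsubmx z)) (v ord0) /\ lsubmx z ord0 ord0 = v ord0 i].
Proof.
move=> fq; pose B := [set x : 'rV[R]_n | exists v : 'rV[R]_k,
  lists_sroots (q x) (v ord0) /\ A (row_mx (v ord0 i)%:M x)].
have sB : sa B.
  apply: sa_ex_rV; apply: sa_and.
    by apply: sa_lists_sroots; [exact: (poly_family_subst fq polymap_fst)|exact: polymap_snd].
  apply: (sa_subst sA); apply: polymap_row_mx; last exact: polymap_fst.
  by apply: polymap_scalar; apply: polymap_entry; exact: polymap_snd.
have Bc : B `<=` @cube R n by move=> x [v [_ /Acube/cube_row[]]].
have -> : [set z : 'rV[R]_(1 + n) | A z /\ exists v : 'rV[R]_k,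
    lists_sroots (q (rsubmx z)) (v ord0) /\ lsubmx z ord0 ord0 = v ord0 i] =
    (fun x => row_mx (root_sel q i x)%:M x : 'rV[R]_(1 + n)) @` B.
  apply/seteqP; split=> z /=.
    move=> [Az [v [Hv zv]]]; exists (rsubmx z).
      by exists v; rewrite -zv row_mx1K.
    by rewrite (root_selE _ Hv) -zv row_mx1K.
  move=> [x [v [Hv Ax]] <-]; rewrite (root_selE _ Hv); split=> //.
  by exists v; rewrite row_mx1_entry0 row_mxKr.
apply: covered_image; first exact: H1.
apply: nash_map_cons; last exact: (nash_map_poly sB polymap_id).
by apply: root_sel_nash => // x [v [Hv _]]; exists v.
Qed.

(** The band is parametrized by a point of the base and the relative position
[u] in (0, 1) between the two roots, through [s + u (s' - s)]. *)
Lemma band_cell_covered (q q' : 'rV[R]_n -> {poly R}) k k' (i : 'I_k) (i' : 'I_k') :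
  poly_family q -> poly_family q' ->
  covered m.+1 [set z : 'rV[R]_(1 + n) | exists (v : 'rV[R]_k) (v' : 'rV[R]_k'),
    [/\ lists_sroots (q (rsubmx z)) (v ord0),
        lists_sroots (q' (rsubmx z)) (v' ord0),
        v ord0 i < lsubmx z ord0 ord0, lsubmx z ord0 ord0 < v' ord0 i' &
        forall y, v ord0 i < y -> y < v' ord0 i' -> A (row_mx y%:M (rsubmx z))]].
Proof.
move=> fq fq'; pose B := [set x : 'rV[R]_n | exists (v : 'rV[R]_k) (v' : 'rV[R]_k'),
  lists_sroots (q x) (v ord0) /\ (lists_sroots (q' x) (v' ord0) /\
    (v ord0 i < v' ord0 i' /\
     forall y, v ord0 i < y -> y < v' ord0 i' -> A (row_mx y%:M x)))].
have sB : sa B.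
  have [p1 p2 p3] := polymap_fst_snd (coords_rV R n) (coords_rV R k) (coords_rV R k').
  apply: sa_ex_rV; apply: sa_ex_rV; apply: sa_and; last apply: sa_and; last apply: sa_and.
  - exact: (sa_lists_sroots (poly_family_subst fq p1) p2).
  - exact: (sa_lists_sroots (poly_family_subst fq' p1) p3).
  - by apply: sa_lt; exact: polymap_entry.
  - pose c := coords_prod (coords_prod (coords_rV R n) (coords_rV R k)) (coords_rV R k').
    have f := @polymap_fst R _ _ c (coordsR R).
    have s := polyfun_of_map (@polymap_snd R _ _ c (coordsR R)).
    apply: sa_all; apply: sa_imp; last apply: sa_imp.
    + by apply: sa_lt => //; exact: (polymap_entry i (polymap_comp f p2)).
    + by apply: sa_lt => //; exact: (polymap_entry i' (polymap_comp f p3)).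
    + apply: (sa_subst sA); apply: polymap_row_mx; last exact: (polymap_comp f p1).
      exact: polymap_scalar.
have Bc : B `<=` @cube R n.
  move=> x [v [v' [_ [_ [vv' Ax]]]]].
  by have /cube_row[] : cube (row_mx ((v ord0 i + v' ord0 i') / 2)%:M x : 'rV[R]_(1 + n))
    by apply/Acube/Ax; lra.
pose s x := root_sel q i x; pose s' x := root_sel q' i' x.
have ns : nash_fun B s by apply: root_sel_nash => // x [v [v' [Hv _]]]; exists v.
have ns' : nash_fun B s' by apply: root_sel_nash => // x [v [v' [_ [Hv _]]]]; exists v'.
pose D := [set z : 'rV[R]_(1 + n) | 0 < lsubmx z ord0 ord0 < 1 /\ B (rsubmx z)].
pose h (z : 'rV[R]_(1 + n)) : R :=
  s (rsubmx z) + lsubmx z ord0 ord0 * (s' (rsubmx z) - s (rsubmx z)).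
have cD : covered m.+1 D.
  apply: covered_prod; apply: H2 => // x [v [v' [_ [_ [vv' Ax]]]]].
  by exists (v ord0 i), (v' ord0 i'); split=> // y /andP[]; exact: Ax.
set C := [set z | _]; have -> : C =
    (fun z => row_mx (h z)%:M (rsubmx z) : 'rV[R]_(1 + n)) @` D.
  apply/seteqP; split=> z /=.
    move=> [v [v' [Hv Hv' vz zv' Az]]].
    have sE : s (rsubmx z) = v ord0 i by exact: root_selE.
    have s'E : s' (rsubmx z) = v' ord0 i' by exact: root_selE.
    have vv' : 0 < v' ord0 i' - v ord0 i by lra.
    exists (row_mx ((lsubmx z ord0 ord0 - v ord0 i) / (v' ord0 i' - v ord0 i))%:M (rsubmx z)).
      rewrite /D /= row_mx1_entry0 row_mxKr; split.
        by rewrite divr_gt0 ?ltr_pdivrMr //=; lra.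
      by exists v, v'; do !split => //; lra.
    rewrite /h row_mx1_entry0 row_mxKr sE s'E divfK ?gt_eqF //.
    by rewrite addrC subrK row_mx1K.
  move=> [x [/andP[x0 x1] [v [v' [Hv [Hv' [vv' Ax]]]]]] <-].
  have sE : s (rsubmx x) = v ord0 i by exact: root_selE.
  have s'E : s' (rsubmx x) = v' ord0 i' by exact: root_selE.
  exists v, v'; rewrite row_mx1_entry0 row_mxKr /h sE s'E.
  by split => //; nra.
have sD := covered_sa cD.
have pr : polymap (fun z : 'rV[R]_(1 + n) => rsubmx z) by apply: polymap_rsub; exact: polymap_id.
have pl : polyfun (fun z : 'rV[R]_(1 + n) => lsubmx z ord0 ord0).
  by apply: polymap_entry; apply: polymap_lsub; exact: polymap_id.
have nr : nash_map D (fun z : 'rV[R]_(1 + n) => rsubmx z) by exact: nash_map_poly.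
apply: covered_image => //; apply: nash_map_cons => //.
have DB z : D z -> B (rsubmx z) by case.
split; last first.
  move=> gamma ga t t1; have gB := nash_arc nr DB ga.
  have a1 := ns.2 _ gB t t1; have a2 := ns'.2 _ gB t t1.
  apply: analytic_add => //; apply: analytic_mul.
    by apply: (polyfun_analytic pl) => l; exact: ga.2.
  apply: analytic_add => //; under eq_fun do rewrite -mulN1r.
  by apply: analytic_mul => //; exact: analytic_cst.
apply: (@sa_ext _ _ _ (fun p => exists a, exists b,
   (D p.1 /\ (B (rsubmx p.1) /\ a = s (rsubmx p.1))) /\
   ((B (rsubmx p.1) /\ b = s' (rsubmx p.1)) /\ p.2 = a + lsubmx p.1 ord0 ord0 * (b - a)))).
  move=> p; split=> [[a [b [[Dp [_ ->]] [[_ ->] ->]]]]|[Dp ->]] //.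
  by exists (s (rsubmx p.1)), (s' (rsubmx p.1)); do !split => //; exact: DB.
have [p1 p2 p3] := polymap_fst_snd (coords_prod (coords_rV R (1 + n)) (coordsR R))
  (coordsR R) (coordsR R).
have p11 := polymap_comp p1 polymap_fst.
have p12 := polymap_comp p1 polymap_snd.
have pz := polymap_comp p11 pr.
apply: sa_ex; apply: sa_ex; apply: sa_and; first apply: sa_and; last apply: sa_and.
- exact: (sa_subst sD p11).
- exact: (sa_subst ns.1 (polymap_pair pz p2)).
- exact: (sa_subst ns'.1 (polymap_pair pz p3)).
- have a2 := polyfun_of_map p2; have a3 := polyfun_of_map p3.
  apply: sa_eq; first exact: polyfun_of_map.
  by apply: polyfun_add => //; apply: polyfun_mul; [exact: (p11 _ pl)|exact: polyfun_sub].
Qed.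

(** A point of [A] is either on the graph of a root function, or strictly
between two consecutive roots.  In the second case no sign changes between
these roots, so that the whole interval is in [A]. *)
Lemma cells_covered : covered m.+1 A.
Proof.
have [L0 fL0 L0P] := sa_signs sA.
have [|N [L [L1L fL sL Lclosed]]] :=
    @derivative_closure n [:: (fun=> 'X), (fun=> 'X - 1) & L0].
  by move=> q; rewrite !inE => /or3P[/eqP->|/eqP->|/fL0//]; exact: poly_family_cst.
pose G (q : 'rV[R]_n -> {poly R}) k (i : 'I_k) :=
  [set z : 'rV[R]_(1 + n) | A z /\ exists v : 'rV[R]_k,
    lists_sroots (q (rsubmx z)) (v ord0) /\ lsubmx z ord0 ord0 = v ord0 i].
pose B (q q' : 'rV[R]_n -> {poly R}) k k' (i : 'I_k) (i' : 'I_k') :=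
  [set z : 'rV[R]_(1 + n) | exists (v : 'rV[R]_k) (v' : 'rV[R]_k'),
    [/\ lists_sroots (q (rsubmx z)) (v ord0),
        lists_sroots (q' (rsubmx z)) (v' ord0),
        v ord0 i < lsubmx z ord0 ord0, lsubmx z ord0 ord0 < v' ord0 i' &
        forall y, v ord0 i < y -> y < v' ord0 i' -> A (row_mx y%:M (rsubmx z))]].
have -> : A =
  [set z | exists2 q, q \in L & exists2 k, k \in iota 0 N.+1 & exists i : 'I_k, G q k i z] `|`
  [set z | exists2 q, q \in L & exists2 k, k \in iota 0 N.+1 & exists i : 'I_k,
    exists2 q', q' \in L & exists2 k', k' \in iota 0 N.+1 & exists i' : 'I_k',
    B q q' k k' i i' z].
  apply/seteqP; split=> z; last first.
    case=> [[q _ [k _ [i []]]]|[q _ [k _ [i [q' _ [k' _ [i' [v [v' [_ _ vz zv' Az]]]]]]]]]] //.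
    by rewrite -(row_mx1K z); apply: Az.
  move=> Az; have /cubeS[z01 _] := Acube Az.
  set x := rsubmx z; set y := lsubmx z ord0 ord0 in z01 *.
  have listed q : q \in L -> exists2 k, k \in iota 0 N.+1 &
      exists v : 'rV[R]_k, lists_sroots (q x) (v ord0).
    move=> qL; have [k kq Hv] := lists_sroots_exists (q x); exists k => //.
    by rewrite mem_iota /= add0n ltnS (leq_trans kq) ?sL.
  have [[q qL qy]|nq] := pselect (exists2 q, q \in L & sroot (q x) y).
    left; exists q => //; have [k kN [v Hv]] := listed q qL.
    exists k => //; have [_ _ vall] := Hv; have [i yi] := vall _ qy.
    by exists i; split => //; exists v.
  right.
  have [||||p pL py|a [b [p [p' [[pL p'L pa p'b ayb] noroot]]]]] :=
      @bracket R [seq q x | q <- L] y.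
  - move=> _ w /mapP[q qL ->] q0 qw; have [r rL rw] := Lclosed q x w qL q0 qw.
    by exists (r x) => //; exact/map_f.
  - by apply/mapP; exists (fun=> 'X) => //; apply: L1L; rewrite !inE eqxx.
  - by apply/mapP; exists (fun=> 'X - 1) => //; apply: L1L; rewrite !inE eqxx orbT.
  - exact: z01.
  - by apply: nq; case/mapP: pL py => q qL -> qy; exists q.
  case/mapP: pL pa => q qL -> qa; case/mapP: p'L p'b => q' q'L -> q'b.
  exists q => //; have [k kN [v Hv]] := listed q qL; exists k => //.
  have [_ _ vall] := Hv; have [i ai] := vall _ qa; exists i.
  exists q' => //; have [k' k'N [v' Hv']] := listed q' q'L; exists k' => //.
  have [_ _ v'all] := Hv'; have [i' bi'] := v'all _ q'b; exists i'.
  exists v, v'; rewrite -/x -/y -ai -bi'; move/andP: (ayb) => [ay yb]; split => //.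
  move=> w aw wb; apply/(L0P x y w); last by rewrite row_mx1K.
  move=> r rL; have [r0|r0] := eqVneq (r x) 0; first by rewrite r0 !horner0.
  apply: (polyrN0_itv (i := `]a, b[)); rewrite ?in_itv /= ?aw ?ay //.
  move=> u uab; apply: noroot => //; apply/mapP; exists r => //.
  by apply: L1L; rewrite !inE rL !orbT.
apply: coveredU; apply: covered_ex_seq => q qL; apply: covered_ex_seq => k _;
  apply: covered_ex_fin => i.
  by apply: graph_cell_covered; exact: fL.
apply: covered_ex_seq => q' q'L; apply: covered_ex_seq => k' _; apply: covered_ex_fin => i'.
by apply: band_cell_covered; exact: fL.
Qed.

End Cells.

(** By induction on the dimension.  A graph has the dimension of its base, which
is small enough for both conclusions.  Over each point of the base of a band in
a hypersurface [f = 0], [f] vanishes on an interval in the first coordinate,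
hence identically: the base lies in the zero set of a nonzero coefficient of
[f], and the dimension of its cells is smaller too. *)
Lemma cube_covered n (A : set 'rV[R]_n) : sa A -> A `<=` @cube R n ->
  covered n.+1 A /\
  forall f : 'rV[R]_n -> R, polyfun f -> (exists z, f z != 0) ->
    (forall x, A x -> f x = 0) -> covered n A.
Proof.
elim: n A => [|n IH] A sA Ac.
  have allE (x y : 'rV[R]_0) : x = y by apply/rowP; case.
  have [[x Ax]|A0] := pselect (exists x, A x); last first.
    have -> : A = set0 by apply/seteqP; split=> x // Ax; case: A0; exists x.
    by split=> *; exact: covered0.
  split=> [|f _ [z fz] fA]; last by move: fz; rewrite (allE z x) fA ?eqxx.
  have -> : A = id @` @cube R 0.
    apply/seteqP; split=> y; first by exists y => // -[].
    by move=> _; rewrite (allE y x).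
  by apply: covered_cell => //; apply: nash_map_poly; [exact: sa_cube|exact: polymap_id].
split.
  apply: (@cells_covered n n.+1 A) => // B sB Bc; last by move=> _; case: (IH B sB Bc).
  by case: (IH B sB Bc) => + _; apply: covered_mono.
move=> f pf [z fz] fA; apply: (@cells_covered n n A) => // B sB Bc.
  by case: (IH B sB Bc).
move=> HB; have [q [qc [D qD]] qE] := polyfun_split (pf : @polyfun R 'rV[R]_(1 + n) _ f).
have [j cj] : exists j, (q (rsubmx (z : 'rV_(1 + n))))`_j != 0.
  apply: contrapT => /forallNP H; move: fz.
  rewrite -(row_mx1K (z : 'rV_(1 + n))) qE.
  have -> : q (rsubmx (z : 'rV_(1 + n))) = 0.
    by apply/polyP => j; rewrite coef0; apply/eqP/negPn/negP/H.
  by rewrite horner0 eqxx.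
have [_ H] := IH B sB Bc; apply: (H (fun x => (q x)`_j)); first exact: qc.
  by eexists; exact: cj.
move=> x /HB[a [b [ab Ax]]]; suff -> : q x = 0 by rewrite coef0.
apply/eqP/negPn/negP => q0.
pose s := [seq a + (b - a) * i.+1%:R^-1 / 2 | i <- iota 0 (size (q x))].
have : (size s < size (q x))%N.
  apply: max_poly_roots => //.
    apply/allP => _ /mapP[i _ ->]; rewrite /root -qE fA //; apply: Ax.
    have i0 : 0 < i.+1%:R^-1 :> R by rewrite invr_gt0.
    have i1 : i.+1%:R^-1 <= 1 :> R by rewrite invf_le1 ?ler1n.
    have h1 : 0 < (b - a) * i.+1%:R^-1 by rewrite mulr_gt0 ?subr_gt0.
    have h2 : (b - a) * i.+1%:R^-1 <= b - a by rewrite ger_pMr ?subr_gt0.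
    move: h1 h2; move: ((b - a) * _) => u h1 h2.
    by apply/andP; split; lra.
  rewrite map_inj_uniq ?iota_uniq // => i j' /addrI /(congr1 (fun u => u * 2)).
  rewrite !divfK ?pnatr_eq0 // => /mulfI; rewrite subr_eq0 gt_eqF // => /(_ isT).
  by move=> /invr_inj/eqP; rewrite eqr_nat eqSS => /eqP.
by rewrite size_map size_iota ltnn.
Qed.

End CellDecomposition.

(** * Noetherianity of arc-symmetric semialgebraic sets *)

Section Noetherian.
Variable R : realType.

Definition noetherian n (S : set 'rV[R]_n) :=
  forall E : nat -> set 'rV[R]_n,
    (forall i, [/\ sa (E i), E i `<=` S & arc_symmetric_in S (E i)]) ->
    (forall i, E i.+1 `<=` E i) -> exists N, forall i, (N <= i)%N -> E i = E N.

Lemma decreasing_le n (E : nat -> set 'rV[R]_n) i j :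
  (forall i, E i.+1 `<=` E i) -> (i <= j)%N -> E j `<=` E i.
Proof.
move=> dE; elim: j => [|j IH]; first by rewrite leqn0 => /eqP ->.
rewrite leq_eqVlt ltnS => /predU1P[->//|/IH]; exact: subset_trans.
Qed.

Lemma arc_symmetric_setI n (S T E : set 'rV[R]_n) : T `<=` S ->
  arc_symmetric_in S E -> arc_symmetric_in T (E `&` T).
Proof.
move=> TS ES gamma ga gE x [t t1 <-]; split; last exact: ga.1.
apply: (ES gamma (analytic_arc_sub TS ga)); last by exists t.
by move=> _ [u u1 <-]; have [] := gE (gamma u) (ex_intro2 _ _ u u1 erefl).
Qed.

Lemma noetherianU n (A B : set 'rV[R]_n) : sa A -> sa B ->
  noetherian A -> noetherian B -> noetherian (A `|` B).
Proof.
move=> sA sB nA nB E HE dE.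
have restr (C : set 'rV[R]_n) : sa C -> C `<=` A `|` B -> noetherian C ->
    exists N, forall i, (N <= i)%N -> E i `&` C = E N `&` C.
  move=> sC CAB nC; apply: (nC (fun i => E i `&` C)) => i.
    have [sE _ aE] := HE i; split; first exact: sa_and sE sC.
      by move=> x [].
    exact: arc_symmetric_setI aE.
  by move=> x [/dE].
have [N HN] := restr A sA (@subsetUl _ A B) nA.
have [M HM] := restr B sB (@subsetUr _ A B) nB.
exists (maxn N M) => i; rewrite geq_max => /andP[Ni Mi].
have split_E j : E j = (E j `&` A) `|` (E j `&` B).
  by rewrite -setIUr; apply/esym/setIidPl; have [] := HE j.
rewrite (split_E i) (split_E (maxn N M)).
by rewrite (HN i) // (HM i) // (HN (maxn N M)) ?leq_maxl // (HM (maxn N M)) ?leq_maxr.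
Qed.

(** Along a map preserving arcs, preimages of arc-symmetric sets are
arc-symmetric. *)
Lemma noetherian_image m n (D : set 'rV[R]_m) (phi : 'rV[R]_m -> 'rV[R]_n) :
  nash_map D phi -> noetherian D -> noetherian (phi @` D).
Proof.
move=> Hphi nD E HE dE.
have [||N HN] := nD (fun i => [set x | D x /\ E i (phi x)]).
- move=> i; have [sE _ aE] := HE i; split.
  + exact: nash_map_preimage Hphi sE.
  + by move=> x [].
  + move=> gamma ga gE _ [t t1 <-]; split; first exact: ga.1.
    have ga' : analytic_arc (phi @` D) (phi \o gamma).
      by apply: nash_arc Hphi _ ga => x Dx; exists x.
    apply: (aE _ ga'); last by exists t.
    by move=> _ [u u1 <-]; have [] := gE (gamma u) (ex_intro2 _ _ u u1 erefl).
- by move=> i x [Dx /dE].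
exists N => i Ni; apply/seteqP; split=> y; first exact: decreasing_le.
have [_ EN _] := HE N.
move=> Ey; have [x Dx xy] := EN _ Ey; rewrite -xy in Ey *.
have : [set x | D x /\ E N (phi x)] x by [].
by rewrite -(HN i Ni) => -[].
Qed.

Lemma covered_noetherian n m (A : set 'rV[R]_n) :
  (forall d, (d < m)%N -> noetherian (@cube R d)) -> covered m A -> noetherian A.
Proof.
move=> Hm; elim=> [|B C cB nB cC nC|d phi dm Hphi].
- move=> E HE dE; exists 0%N => i _.
  suff E0 j : E j = set0 by rewrite !E0.
  by apply/seteqP; split=> // x; have [_ H _] := HE j; exact: H.
- exact: noetherianU (covered_sa cB) (covered_sa cC) nB nC.
- by apply: noetherian_image => //; exact: Hm.
Qed.

Lemma analytic_arc_affine n (S : set 'rV[R]_n) gamma k l :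
  analytic_arc S gamma -> (forall t, -1 < t < 1 -> -1 < k * t + l < 1) ->
  analytic_arc S (fun t => gamma (k * t + l)).
Proof.
move=> [gS ga] kl; split=> [t /=|i t /=]; rewrite in_itv /= => t1.
  by apply: gS; rewrite /= in_itv /= kl.
by apply: (@analytic_affine _ (fun u => gamma u ord0 i)); apply: ga; rewrite /= in_itv /= kl.
Qed.

(** If the arc left [E] at a time [s] before 1, an affine reparametrization
centred at [s] would be in [E] at negative times but not at all times. *)
Lemma arc_symmetric_extend n (S E : set 'rV[R]_n) gamma a b :
  arc_symmetric_in S E -> analytic_arc S gamma -> -1 <= a -> a < b -> b <= 1 ->
  (forall t, a < t < b -> E (gamma t)) -> forall t, a < t < 1 -> E (gamma t).
Proof.
move=> ES ga a1 ab b1 gab.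
pose W := [set c | c <= 1 /\ forall t, a < t < c -> E (gamma t)].
have Wb : W b by [].
have W1 : ubound W 1 by move=> c [].
have supW : has_sup W by split; [exists b|exists 1].
set s := sup W.
have bs : b <= s by apply: ub_le_sup => //; exists 1.
have gs t : a < t < s -> E (gamma t).
  move=> /andP[at_ ts]; have ts0 : 0 < s - t by rewrite subr_gt0.
  have [c [c1 Wc] tc] := sup_adherent ts0 supW; apply: Wc.
  by rewrite at_; move: tc; rewrite -/s opprB addrC subrK.
have [s1|s1] := leP 1 s.
  by move=> t /andP[at_ t1]; apply: gs; rewrite at_ (lt_le_trans t1).
pose h := Num.min (s - a) (1 - s).
have h0 : 0 < h by rewrite lt_min !subr_gt0 s1 (lt_le_trans ab).
have hs : h <= s - a by rewrite ge_min lexx.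
have h1 : h <= 1 - s by rewrite ge_min lexx orbT.
have ga' : analytic_arc S (fun t => gamma (h * t + s)).
  by apply: analytic_arc_affine => // t /andP[t0 t1]; apply/andP; split; nra.
have Hs : W (s + h).
  split; first lra.
  move=> t /andP[at_ th]; have [ts|st] := ltP t s; first by apply: gs; rewrite at_.
  have -> : t = h * ((t - s) / h) + s by field; rewrite gt_eqF.
  apply: (ES _ ga'); last first.
    exists ((t - s) / h) => //=; rewrite in_itv /= ltr_pdivrMr // ltr_pdivlMr //.
    by apply/andP; split; lra.
  move=> _ [u + <-]; rewrite /= in_itv /= => /andP[u0 u1]; apply: gs.
  by apply/andP; split; nra.
have := ub_le_sup (ex_intro _ 1 W1) Hs; rewrite -/s.
by move=> ?; exfalso; lra.
Qed.

Lemma polyfun_line n (f : 'rV[R]_n -> R) (x y : 'rV[R]_n) : polyfun f ->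
  exists p : {poly R}, forall t, f (x + t *: (y - x)) = p.[t].
Proof.
elim=> {f} [a|i|f g _ [p pE] _ [q qE]|f g _ [p pE] _ [q qE]].
- by exists a%:P => t; rewrite hornerC.
- have [Hi|Hi] := ltnP i n; last first.
    by exists 0 => t; rewrite horner0 nth_default // size_coords_rV.
  exists ((x ord0 (Ordinal Hi))%:P + (y ord0 (Ordinal Hi) - x ord0 (Ordinal Hi)) *: 'X) => t.
  rewrite coords_rVE (nth_map (Ordinal Hi)) ?size_enum_ord //.
  by rewrite (nth_ord_enum (Ordinal Hi) (Ordinal Hi)) !mxE !hornerE mulrC.
- by exists (p + q) => t; rewrite hornerD pE qE.
- by exists (p * q) => t; rewrite hornerM pE qE.
Qed.

(** Restrict both functions to the line through a point where the first does
not vanish and a point where the second does not. *)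
Lemma polyfun_mul_neq0 n (f g : 'rV[R]_n -> R) : polyfun f -> polyfun g ->
  (exists x, f x != 0) -> (exists x, g x != 0) -> exists x, f x * g x != 0.
Proof.
move=> pf pg [x fx] [y gy].
have [p pE] := polyfun_line x y pf; have [q qE] := polyfun_line x y pg.
have p0 : p != 0.
  by apply: contraNneq fx => p0; have := pE 0; rewrite scale0r addr0 p0 horner0 => ->.
have q0 : q != 0.
  by apply: contraNneq gy => q0; have := qE 1; rewrite scale1r addrC subrK q0 horner0 => ->.
have pq0 : p * q != 0 by rewrite mulf_neq0.
have [t pt] : exists t, (p * q).[t] != 0.
  apply: contrapT => /forallNP H.
  have : (size [seq i%:R : R | i <- iota 0 (size (p * q)%R)] < size (p * q)%R)%N.
    apply: max_poly_roots => //; first by apply/allP => _ /mapP[i _ ->]; apply/negPn/negP/H.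
    by rewrite map_inj_uniq ?iota_uniq // => i j /eqP; rewrite eqr_nat => /eqP.
  by rewrite size_map size_iota ltnn.
by exists (x + t *: (y - x)); rewrite pE qE -hornerM.
Qed.

Lemma horner_near_gt0 (p : {poly R}) t0 : 0 < p.[t0] -> \forall t \near t0, 0 < p.[t].
Proof.
move=> p0; have : real_analytic_at (fun t => p.[t]) t0.
  apply: (@horner_analytic _ (fun=> p) (size p)) => [//|j|]; first exact: analytic_cst.
  exact: analytic_id.
by move=> /analytic_continuous /cvgr_gt; apply.
Qed.

(** The cube is open and convex, so the segment between two of its points can
be prolonged a little at both ends. *)
Lemma line_arc n (x y : 'rV[R]_n) : cube x -> cube y ->
  exists2 e, 0 < e & forall t, - e < t < 1 + e -> cube (x + t *: (y - x)).
Proof.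
move=> cx cy.
have near_cube t0 : cube (x + t0 *: (y - x)) ->
    \forall t \near t0, cube (x + t *: (y - x)).
  move=> c0; apply: (@filter_forall _ 'I_n
    (fun i t => 0 < (x + t *: (y - x)) ord0 i < 1) (nbhs t0)) => i.
  have [p pE] := polyfun_line x y (polyfun_entry R i).
  move: (c0 i); rewrite pE => /andP[p0 p1].
  have p1' : 0 < (1 - p).[t0] by rewrite hornerD hornerN hornerC subr_gt0.
  near=> t; rewrite pE; apply/andP; split; first by near: t; exact: horner_near_gt0.
  have : 0 < (1 - p).[t] by near: t; exact: horner_near_gt0.
  by rewrite hornerD hornerN hornerC subr_gt0.
have /near_cube/nbhs_ballP[e1 /= e10 He1] : cube (x + 0 *: (y - x)) by rewrite scale0r addr0.
have /near_cube/nbhs_ballP[e2 /= e20 He2] : cube (x + 1 *: (y - x)) by rewrite scale1r addrC subrK.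
exists (Num.min e1 e2); first by rewrite lt_min e10.
move=> t /andP[]; rewrite ltrNl lt_min => /andP[t1 t2].
rewrite -ltrBlDl lt_min => /andP[t3 t4].
have [t0|t0] := ltP t 0.
  by apply: He1; rewrite /ball /= sub0r normrN ler0_norm // ltW.
have [t1'|t1'] := ltP 1 t.
  by apply: He2; rewrite /ball /= ler0_norm ?subr_le0 ?(ltW t1') // opprB.
move=> i; rewrite !mxE; move: (cx i) (cy i) => /andP[x0 x1] /andP[y0 y1].
have t1s : 0 <= 1 - t by rewrite subr_ge0.
have [xy|/ltW yx] := leP (x ord0 i) (y ord0 i).
  have h1 := mulr_ge0 t0 (_ : 0 <= y ord0 i - x ord0 i).
  have h2 := mulr_ge0 t1s (_ : 0 <= y ord0 i - x ord0 i).
  by rewrite subr_ge0 in h1 h2; apply/andP; split; [have := h1 xy|have := h2 xy]; lra.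
have h1 := mulr_ge0 t0 (_ : 0 <= x ord0 i - y ord0 i).
have h2 := mulr_ge0 t1s (_ : 0 <= x ord0 i - y ord0 i).
by rewrite subr_ge0 in h1 h2; apply/andP; split; [have := h2 yx|have := h1 yx]; lra.
Unshelve. all: by end_near.
Qed.

(** If a nonempty basic set is cut out without nontrivial equations, then it
contains a small interval of each line through one of its points, so that an
arc-symmetric set containing it is the whole cube. *)
Lemma arc_symmetric_hypersurface n (E : set 'rV[R]_n) :
  semialgebraic E -> E `<=` @cube R n -> arc_symmetric_in (@cube R n) E ->
  E <> @cube R n ->
  exists f : 'rV[R]_n -> R, [/\ polyfun f, exists z, f z != 0 & forall x, E x -> f x = 0].
Proof.
move=> [s Es] Ec aE Ene.
have H PQ : PQ \in s -> exists f : 'rV[R]_n -> R, [/\ polyfun f, exists z, f z != 0 &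
    forall x, basic_semialgebraic PQ.1 PQ.2 x -> f x = 0].
  move=> PQs; have [[p pP [z pz]]|triv] :=
      pselect (exists2 p, p \in PQ.1 & exists z, peval z p != 0).
    exists (fun x => peval x p); split; [exact: polyfun_peval|by exists z|].
    by move=> x [+ _]; apply.
  have [[x Bx]|B0] := pselect (exists x, basic_semialgebraic PQ.1 PQ.2 x); last first.
    exists (fun=> 1); split; [exact: polyfun_cst|by exists 0; exact: oner_neq0|].
    by move=> x Bx; case: B0; exists x.
  have BE w : basic_semialgebraic PQ.1 PQ.2 w -> E w by rewrite Es => Bw; exists PQ.
  case: Ene; apply/seteqP; split => // y cy.
  have cx := Ec _ (BE _ Bx).
  have near_B : \forall t \near (0 : R), E (x + t *: (y - x)).
    have nearQ : \forall t \near (0 : R), forall q, q \in PQ.2 -> 0 < peval (x + t *: (y - x)) q.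
      have {Bx} : forall q, q \in PQ.2 -> 0 < peval x q by case: Bx.
      elim: PQ.2 => [|q Q IH] HQ; first by near=> t.
      have [p pE] := polyfun_line x y (polyfun_peval q).
      have Hq : \forall t \near (0 : R), 0 < p.[t].
        apply: horner_near_gt0; rewrite -pE scale0r addr0; exact/HQ/mem_head.
      have HQ' : forall q', q' \in Q -> 0 < peval x q'.
        by move=> q' q'Q; apply: HQ; rewrite inE q'Q orbT.
      have {}IH := IH HQ'.
      near=> t => q'; rewrite inE => /predU1P[->|].
        by rewrite pE; near: t.
      by move: q'; near: t.
    apply: filterS nearQ => t Qt; apply: BE; split=> // p pP.
    by apply/eqP/negPn/negP => pz; apply: triv; exists p => //; eexists; exact: pz.
  have [e e0 He] := line_arc cx cy.
  have /nbhs_ballP[d /= d0 Hd] := near_B.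
  (* the segment from x to y, slightly prolonged, parametrized by (-1, 1) *)
  pose k := (1 + 2 * e) / 2.
  have k0 : 0 < k by rewrite /k; lra.
  pose gamma t := x + (k * t + 1 / 2) *: (y - x).
  have ga : analytic_arc (@cube R n) gamma.
    split=> [t /=|i t _].
      rewrite in_itv /= => /andP[t0 t1]; apply: He; rewrite /k; apply/andP; split; nra.
    have [p pE] := polyfun_line x y (polyfun_entry R i).
    under eq_fun do rewrite /gamma pE.
    apply: (@analytic_affine _ (fun u => p.[u])).
    apply: (@horner_analytic _ (fun=> p) (size p)) => [//|j|]; first exact: analytic_cst.
    exact: analytic_id.
  pose t0 := - (1 / 2) / k; pose r := Num.min d e / k.
  have m0 : 0 < Num.min d e by rewrite lt_min d0.
  have md : Num.min d e <= d by rewrite ge_min lexx.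
  have me : Num.min d e <= e by rewrite ge_min lexx orbT.
  have r0 : 0 < r by rewrite divr_gt0.
  have kt0 : k * t0 = - (1 / 2) by rewrite /t0 mulrC divfK // gt_eqF.
  have kr : k * r = Num.min d e by rewrite /r mulrC divfK // gt_eqF.
  have Ey : E (gamma ((1 / 2) / k)).
    apply: (@arc_symmetric_extend _ _ _ gamma (t0 - r) (t0 + r) aE ga).
    - rewrite -subr_ge0 -(pmulr_rge0 _ k0); rewrite mulrBr mulrBr kt0 kr /k; lra.
    - lra.
    - rewrite -subr_ge0 -(pmulr_rge0 _ k0); rewrite mulrBr mulrDr kt0 kr /k; lra.
    - move=> t /andP[ta tb]; apply: Hd; rewrite /ball /= sub0r normrN ltr_norml.
      by apply/andP; split; nra.
    - rewrite ltr_pdivrMr // ltr_pdivlMr // /k; apply/andP; split; last lra.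
      have : (t0 - r) * k < 1 / 2 by rewrite mulrC mulrBr kt0 kr; lra.
      by [].
  move: Ey; rewrite /gamma [k * _]mulrC divfK ?gt_eqF //.
  have -> : 1 / 2 + 1 / 2 = 1 :> R by lra.
  by rewrite scale1r addrC subrK.
have {H} : exists f : 'rV[R]_n -> R, [/\ polyfun f, exists z, f z != 0 &
    forall x, (exists2 PQ, PQ \in s & basic_semialgebraic PQ.1 PQ.2 x) -> f x = 0].
  elim: s H {Es} => [|PQ s IH] H.
    exists (fun=> 1); split; [exact: polyfun_cst|by exists 0; exact: oner_neq0|].
    by move=> x [].
  have [f [pf fz f0]] := H PQ (mem_head _ _).
  have [|g [pg gz g0]] := IH; first by move=> r rs; apply: H; rewrite inE rs orbT.
  exists (fun x => f x * g x); split; [exact: polyfun_mul|exact: polyfun_mul_neq0|].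
  move=> x [r]; rewrite inE => /predU1P[->|rs] Hr; first by rewrite f0 ?mul0r.
  by rewrite g0 ?mulr0 //; exists r.
by move=> [f [pf fz f0]]; exists f; split => // x; rewrite Es; exact: f0.
Unshelve. all: by end_near.
Qed.

(** As soon as a member of the chain is not the whole cube, it is covered by
cubes of smaller dimension, for which the chain condition is known. *)
Lemma cube_noetherian d : noetherian (@cube R d).
Proof.
elim/ltn_ind: d => d IH E HE dE.
have [Eall|/existsNP[i0 Ene]] := pselect (forall i, E i = @cube R d).
  by exists 0%N => i _; rewrite !Eall.
have [sE Ec aE] := HE i0.
have [f [pf fz f0]] := arc_symmetric_hypersurface ((semialgebraicP _).2 sE) Ec aE Ene.
have [_ /(_ f pf fz f0) cE] := cube_covered sE Ec.
have [||N HN] := covered_noetherian IH cE (E := fun i => E (i0 + i)%N).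
- move=> i; have [sEi Eci aEi] := HE (i0 + i)%N.
  have sub : E (i0 + i)%N `<=` E i0 by apply: decreasing_le => //; exact: leq_addr.
  split => //; have := arc_symmetric_setI Ec aEi.
  by rewrite ((setIidPl _ _).2 sub).
- by move=> i; rewrite addnS; exact: dE.
exists (i0 + N)%N => i i0N; rewrite -(HN (i - i0)%N); last first.
  by rewrite leq_subRL // (leq_trans _ i0N) // leq_addr.
by rewrite subnKC // (leq_trans _ i0N) // leq_addr.
Qed.

(** An analytic bijection of (0, 1) with the line, used to bring unbounded sets
into the cube *)
Definition stretch n (x : 'rV[R]_n) : 'rV[R]_n :=
  \row_i ((2 * x ord0 i - 1) / (x ord0 i * (1 - x ord0 i))).

Lemma stretch_nash n (D : set 'rV[R]_n) : sa D -> D `<=` @cube R n ->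
  nash_map D (@stretch n).
Proof.
move=> sD Dc; split.
  apply: (@sa_ext _ _ _ (fun p : 'rV[R]_n * 'rV[R]_n => D p.1 /\ forall i, p.2 ord0 i *
    (p.1 ord0 i * (1 - p.1 ord0 i)) = 2 * p.1 ord0 i - 1)).
    move=> p; split=> -[Dp H]; split => //.
      apply/rowP => i; rewrite mxE -H mulfK // mulf_neq0 //.
        by rewrite gt_eqF //; have /andP[] := Dc _ Dp i.
      by rewrite subr_eq0 gt_eqF //; have /andP[] := Dc _ Dp i.
    move=> i; rewrite H mxE divfK // mulf_neq0 //.
      by rewrite gt_eqF //; have /andP[] := Dc _ Dp i.
    by rewrite subr_eq0 gt_eqF //; have /andP[] := Dc _ Dp i.
  apply: sa_and; first exact: (sa_subst sD polymap_fst).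
  apply: sa_all_fin => i.
  have p1 : polyfun (fun p : 'rV[R]_n * 'rV[R]_n => p.1 ord0 i).
    exact: (polymap_entry i polymap_fst).
  have p2 : polyfun (fun p : 'rV[R]_n * 'rV[R]_n => p.2 ord0 i).
    exact: (polymap_entry i polymap_snd).
  apply: sa_eq.
    apply: polyfun_mul => //; apply: polyfun_mul => //; apply: polyfun_sub => //.
    exact: polyfun_cst.
  by apply: polyfun_sub; [apply: polyfun_mul => //|]; exact: polyfun_cst.
move=> gamma [gD ga] i t t1; under eq_fun do rewrite mxE.
have gi := ga i t t1; have /andP[g0 g1] := Dc _ (gD t t1) i.
have opp f : real_analytic_at f t -> real_analytic_at (fun t => - f t) t.
  move=> fa; under eq_fun do rewrite -mulN1r.
  by apply: analytic_mul => //; exact: analytic_cst.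
apply: analytic_mul.
  apply: analytic_add; last exact: analytic_cst.
  by apply: analytic_mul => //; exact: analytic_cst.
apply: analytic_inv; last by rewrite mulf_neq0 ?gt_eqF ?subr_gt0.
apply: analytic_mul => //; apply: analytic_add; first exact: analytic_cst.
exact: opp.
Qed.

Lemma stretch_surj n (y : 'rV[R]_n) : exists2 x, cube x & stretch x = y.
Proof.
have H (z : R) : exists u, 0 < u < 1 /\ (2 * u - 1) / (u * (1 - u)) = z.
  pose p : {poly R} := z *: 'X^2 + (2 - z) *: 'X - 1.
  have pE u : p.[u] = z * u ^+ 2 + (2 - z) * u - 1.
    by rewrite /p !hornerE.
  have [|u /andP[u0 u1] /eqP] := @poly_ivt _ p 0 1 ler01 _.
    by rewrite !pE; apply/andP; split; lra.
  rewrite pE => pu.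
  have u0' : u != 0 by apply/eqP => u00; move: pu; rewrite u00; lra.
  have u1' : u != 1 by apply/eqP => u00; move: pu; rewrite u00; lra.
  exists u; split; first by rewrite !lt_neqAle u0 u1 eq_sym u0' u1'.
  have d0 : u * (1 - u) != 0 by rewrite mulf_neq0 // subr_eq0 eq_sym.
  by apply: (mulIf d0); rewrite divfK //; lra.
have /choice[u Hu] : forall i, exists u, 0 < u < 1 /\ (2 * u - 1) / (u * (1 - u)) = y ord0 i.
  by move=> i; exact: H.
exists (\row_i u i); first by move=> i; rewrite mxE; have [] := Hu i.
by apply/rowP => i; rewrite !mxE; have [] := Hu i.
Qed.

Theorem semialgebraic_noetherian n (S : set 'rV[R]_n) : sa S -> noetherian S.
Proof.
move=> sS; pose D := [set x : 'rV[R]_n | cube x /\ S (stretch x)].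
have sD : sa D.
  by apply: nash_map_preimage sS; apply: stretch_nash => //; exact: sa_cube.
have Dc : D `<=` @cube R n by move=> x [].
have -> : S = @stretch n @` D.
  apply/seteqP; split=> y; last by move=> [x [_ Sx] <-].
  by move=> Sy; have [x cx xy] := stretch_surj y; exists x => //; split; rewrite ?xy.
apply: noetherian_image; first exact: stretch_nash.
have [cD _] := cube_covered sD Dc.
by apply: covered_noetherian cD => d _; exact: cube_noetherian.
Qed.

End Noetherian.

(** * Arc-analytic functions and their zero sets *)

Section ZeroSets.
Variable R : realType.

Lemma semialgebraic_funP n (S : set 'rV[R]_n) f :
  semialgebraic_fun S f <-> sa (fun p : 'rV[R]_n * R => S p.1 /\ p.2 = f p.1).
Proof.
have graphP x (z : R) : graph_on S f (row_mx x z%:M) <-> S x /\ z = f x.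
  split=> [[x' Sx' /eq_row_mx[xx' fz]]|[Sx ->]]; last by exists x.
  rewrite -xx'; split=> //; have := congr1 (fun A : 'M[R]_1 => A ord0 ord0) fz.
  by rewrite !mxE eqxx !mulr1n.
rewrite /semialgebraic_fun; split=> [/semialgebraicP|] sg.
  apply: (@sa_ext _ _ _ (fun p : 'rV[R]_n * R => graph_on S f (row_mx p.1 p.2%:M))).
    by move=> p; exact: graphP.
  apply: (sa_subst (h := fun p : 'rV[R]_n * R => row_mx p.1 (p.2%:M : 'M[R]_1)) sg).
  apply: polymap_row_mx; first exact: polymap_fst.
  exact/polymap_scalar/polyfun_of_map/polymap_snd.
apply/semialgebraicP; apply: (@sa_ext _ _ _ (fun z : 'rV[R]_(n + 1) =>
    S (lsubmx z) /\ rsubmx z ord0 ord0 = f (lsubmx z))).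
  by move=> z; rewrite -graphP -mx11_scalar hsubmxK.
apply: (sa_subst (h := fun z : 'rV[R]_(n + 1) => (lsubmx z, rsubmx z ord0 ord0)) sg).
apply: polymap_pair; first by apply: polymap_lsub; exact: polymap_id.
by apply/polymap_fun/polymap_entry/polymap_rsub; exact: polymap_id.
Qed.

Lemma aA_nash n (S : set 'rV[R]_n) f : aA S f <-> nash_fun S f.
Proof. by split=> -[/semialgebraic_funP sg fa]; split=> //; exact/semialgebraic_funP. Qed.

Lemma nash_fun_cst n (S : set 'rV[R]_n) (k : R) : sa S -> nash_fun S (fun=> k).
Proof.
move=> sS; split; last by move=> gamma _ t _; exact: analytic_cst.
apply: sa_and; first exact: (sa_subst sS polymap_fst).
by apply: sa_eq; [exact/polyfun_of_map/polymap_snd|exact: polyfun_cst].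
Qed.

Lemma nash_fun_sum_sqr n (S : set 'rV[R]_n) (f g : 'rV[R]_n -> R) :
  nash_fun S f -> nash_fun S g -> nash_fun S (fun x => f x ^+ 2 + g x ^+ 2).
Proof.
move=> [sf fa] [sg ga]; split; last first.
  move=> gamma Hg t t1; apply: analytic_add; apply: analytic_exp.
    exact: fa.
  exact: ga.
apply: (@sa_ext _ _ _ (fun p : 'rV[R]_n * R => exists a, exists b,
    (S p.1 /\ a = f p.1) /\ ((S p.1 /\ b = g p.1) /\ p.2 = a ^+ 2 + b ^+ 2))).
  move=> p; split=> [[a [b [[Sp ->] [[_ ->] ->]]]]|[Sp ->]] //.
  by exists (f p.1), (g p.1).
have [p1 p2 p3] := polymap_fst_snd (coords_prod (coords_rV R n) (coordsR R))
  (coordsR R) (coordsR R).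
have p11 := polymap_comp p1 polymap_fst.
apply: sa_ex; apply: sa_ex; apply: sa_and; last apply: sa_and.
- exact: (sa_subst sf (polymap_pair p11 p2)).
- exact: (sa_subst sg (polymap_pair p11 p3)).
- apply: sa_eq; first exact: (polyfun_of_map (polymap_comp p1 polymap_snd)).
  by apply: polyfun_add; apply: polyfun_exp; exact: polyfun_of_map.
Qed.

(** Zeros are isolated or fill a neighbourhood, so the first time after which
the vanishing stops cannot be interior. *)
Lemma analytic_identity (g : R -> R) a b :
  real_analytic_on `]-1, 1[ g -> -1 <= a -> a < b -> b <= 1 ->
  (forall t, a < t < b -> g t = 0) -> forall t, a < t < 1 -> g t = 0.
Proof.
move=> ga a1 ab b1 gab.
pose W := [set c | c <= 1 /\ forall t, a < t < c -> g t = 0].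
have Wb : W b by [].
have W1 : ubound W 1 by move=> c [].
have supW : has_sup W by split; [exists b|exists 1].
set s := sup W.
have bs : b <= s by apply: ub_le_sup => //; exists 1.
have gs t : a < t < s -> g t = 0.
  move=> /andP[at_ ts]; have ts0 : 0 < s - t by rewrite subr_gt0.
  have [c [c1 Wc] tc] := sup_adherent ts0 supW; apply: Wc.
  by rewrite at_; move: tc; rewrite -/s opprB addrC subrK.
have [s1|s1] := leP 1 s.
  by move=> t /andP[at_ t1]; apply: gs; rewrite at_ (lt_le_trans t1).
have as_ : a < s by exact: lt_le_trans bs.
have : real_analytic_at g s by apply: ga; rewrite /= in_itv /=; apply/andP; split; lra.
case/analytic_zeros => /nbhs_ballP[e /= e0 He].
  have Hs : W (Num.min (s + e) 1).
    split; first by rewrite ge_min lexx orbT.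
    move=> t /andP[at_]; rewrite lt_min => /andP[te t1].
    have [ts|st] := ltP t s; first by apply: gs; rewrite at_.
    by apply: He; rewrite /ball /= ler0_norm ?subr_le0 // opprB; lra.
  have := ub_le_sup (ex_intro _ 1 W1) Hs; rewrite -/s ge_min.
  by move=> /orP[]; move=> ?; exfalso; lra.
pose h := Num.min e (s - a) / 2.
have h0 : 0 < h by rewrite divr_gt0 // lt_min e0 subr_gt0.
have he : h < e by rewrite ltr_pdivrMr // gt_min; apply/orP; left; lra.
have ha : h < s - a by rewrite ltr_pdivrMr // gt_min; apply/orP; right; lra.
have /He : ball s e (s - h).
  by rewrite /ball /= opprB addrC subrK ger0_norm // ltW.
rewrite gs; last by apply/andP; split; lra.
by rewrite eqxx => H; exfalso; suff : false by []; apply: H; rewrite lt_eqF //; lra.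
Qed.

(** Arc-symmetry of a zero set is the identity principle along arcs. *)
Lemma zero_set_arc_symmetric n (S : set 'rV[R]_n) (f : 'rV[R]_n -> R) :
  nash_fun S f -> [/\ sa (fun x => S x /\ f x = 0), (fun x => S x /\ f x = 0) `<=` S &
    arc_symmetric_in S (fun x => S x /\ f x = 0)].
Proof.
move=> [sf fa]; split; first last.
- move=> gamma Hg g0 _ [t t1 <-]; split; first exact: Hg.1.
  have /= t1' := t1; rewrite in_itv /= in t1'.
  apply: (analytic_identity (fa _ Hg) (lexx (-1)) (b := 0)) => // u u0.
  by have [] := g0 (gamma u) (ex_intro2 _ _ u u0 erefl).
- by move=> x [].
apply: (@sa_ext _ _ _ (fun x => S x /\ 0 = f x)).
  by move=> x; split=> -[Sx ->].
apply: (sa_subst (h := fun x => (x, 0 : R)) sf).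
by apply: polymap_pair; [exact: polymap_id|exact/polymap_fun/polyfun_cst].
Qed.

Section AdjoinPoint.
Variables (n : nat) (S X : set 'rV[R]_n) (y : 'rV[R]_n).
Hypotheses (HX : AR_closed S X) (Sy : S y) (Xy : ~ X y).

Let sqdist (x : 'rV[R]_n) : R := \sum_(i < n) (x ord0 i - y ord0 i) ^+ 2.

Lemma sqdist_eq0 x : sqdist x = 0 <-> x = y.
Proof.
split=> [/eqP|->]; last by apply: big1 => i _; rewrite subrr expr0n.
rewrite psumr_eq0 => [/allP H|i _]; last exact: sqr_ge0.
apply/rowP => i; apply/eqP; rewrite -subr_eq0 -sqrf_eq0.
exact: (H i (mem_index_enum i)).
Qed.

Lemma sqdist_analytic gamma : analytic_arc S gamma ->
  real_analytic_on `]-1, 1[ (fun t => sqdist (gamma t)).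
Proof.
move=> [_ ga] t t1; apply: (@polyfun_analytic _ n sqdist) => [|i]; last exact: ga.
apply: polyfun_sum => i; apply: polyfun_exp; apply: polyfun_sub.
  exact: polyfun_entry.
exact: polyfun_cst.
Qed.

Lemma sa_adjoin : sa (X `|` [set y]).
Proof.
have [/semialgebraicP sX _ _] := HX; apply: sa_or => //.
apply: sa_eq_rV; first exact: polymap_id.
by apply: polymap_rV => i; exact: polyfun_cst.
Qed.

(** The squared distance to [y] is analytic along the arc, and the zeros of an
analytic function are isolated or fill a neighbourhood. *)
Lemma arc_dichotomy gamma (t0 : R) : analytic_arc S gamma -> -1 < t0 < 1 ->
  (\forall t \near t0, gamma t = y) \/ (\forall t \near t0, t != t0 -> gamma t <> y).
Proof.
move=> ga t1; have := sqdist_analytic ga; move=> /(_ t0).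
rewrite /= in_itv /= => /(_ t1)/analytic_zeros[]H; [left|right]; near=> t.
  by apply/sqdist_eq0; near: t.
move=> tt0 /sqdist_eq0; apply/eqP; move: tt0; near: t; exact: H.
Unshelve. all: by end_near.
Qed.

(** An arc that lies in [X] with [y] adjoined at negative times is either at
[y] on an interval, hence from then on by the identity principle, or in [X] on
an interval, hence from then on by arc-symmetry. *)
Lemma AR_closed_adjoin : AR_closed S (X `|` [set y]).
Proof.
have [_ XS aX] := HX; split.
- exact/semialgebraicP/sa_adjoin.
- by move=> x [/XS|->].
move=> gamma ga gX _ [t t1 <-].
have t1' : -1 < t < 1 by move: t1; rewrite /= in_itv.
have [t0|t0] := ltP t 0.
  by apply: gX; exists t => //; rewrite /= in_itv /= t0 andbT; case/andP: t1'.
have h1 : -1 < (- 2^-1 : R) < 1 by apply/andP; split; lra.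
have [/nbhs_ballP[e /= e0 He]|/nbhs_ballP[e /= e0 He]] := @arc_dichotomy gamma _ ga h1.
  right; apply/sqdist_eq0.
  have m0 : 0 < Num.min e 2^-1 by rewrite lt_min e0 /=; lra.
  have me : Num.min e 2^-1 <= e by rewrite ge_min lexx.
  have m2 : Num.min e 2^-1 <= 2^-1 by rewrite ge_min lexx orbT.
  apply: (analytic_identity (sqdist_analytic ga)
    (a := - 2^-1) (b := - 2^-1 + Num.min e 2^-1)); try lra.
  move=> u /andP[u1 u2]; apply/sqdist_eq0; apply: He.
  by rewrite /ball /= ler0_norm ?subr_le0 ?ltW // opprB; lra.
left.
have m0 : 0 < Num.min e 2^-1 by rewrite lt_min e0 /=; lra.
have me : Num.min e 2^-1 <= e by rewrite ge_min lexx.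
have m2 : Num.min e 2^-1 <= 2^-1 by rewrite ge_min lexx orbT.
apply: (arc_symmetric_extend aX ga (a := - 2^-1) (b := - 2^-1 + Num.min e 2^-1)); try lra.
move=> u /andP[u1 u2].
have u0 : `]-1, 0[%classic u by rewrite /= in_itv /=; lra.
have [//|/= uy] := gX (gamma u) (ex_intro2 _ _ u u0 erefl).
exfalso; apply: (He u) uy; last by rewrite gt_eqF.
by rewrite /ball /= ler0_norm ?subr_le0 ?ltW // opprB; lra.
Qed.

(** Near each time the arc is either constantly [y] or in [X]: being in [X] just
before some time, it is still in [X] at that time. *)
Lemma indicator_adjoin : nash_fun (X `|` [set y]) (fun x => (x == y)%:R).
Proof.
have [/semialgebraicP sX XS aX] := HX; split.
  apply: (@sa_ext _ _ _ (fun p : 'rV[R]_n * R => (X p.1 /\ p.2 = 0) \/ (p.1 = y /\ p.2 = 1))).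
    move=> [x z] /=; split=> [[[Xx ->]|[-> ->]]|[[Xx|/= ->] ->]].
    - by split; [left|case: eqP Xx => // -> /Xy].
    - by split; [right|rewrite eqxx].
    - by left; split=> //; case: eqP Xx => // -> /Xy.
    - by right; rewrite eqxx.
  apply: sa_or; apply: sa_and.
  - exact: (sa_subst sX polymap_fst).
  - by apply: sa_eq; [exact/polyfun_of_map/polymap_snd|exact: polyfun_cst].
  - apply: sa_eq_rV; first exact: polymap_fst.
    by apply: polymap_rV => i; exact: polyfun_cst.
  - by apply: sa_eq; [exact/polyfun_of_map/polymap_snd|exact: polyfun_cst].
move=> gamma gXy t0 t1.
have ga : analytic_arc S gamma by apply: analytic_arc_sub gXy => x [/XS|->].
have t1' : -1 < t0 < 1 by move: t1; rewrite /= in_itv.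
have [gy|/nbhs_ballP[e /= e0 He]] := @arc_dichotomy gamma _ ga t1'.
  apply: analytic_near (analytic_cst 1 t0); near=> t.
  have -> : gamma t = y by near: t.
  by rewrite eqxx.
(* the arc is in X just before t0, hence at t0 *)
have X0 : X (gamma t0).
  pose h := Num.min e (t0 + 1).
  have h0 : 0 < h by rewrite lt_min e0 /=; case/andP: t1' => *; lra.
  have he : h <= e by rewrite ge_min lexx.
  have ht : h <= t0 + 1 by rewrite ge_min lexx orbT.
  have [t10 t11] := andP t1'.
  apply: (arc_symmetric_extend aX ga (a := t0 - h) (b := t0)); try lra.
  move=> u /andP[u1 u2].
  have u0 : `]-1, 1[%classic u by rewrite /= in_itv /=; lra.
  have [//|/= uy] := gXy.1 u u0.
  exfalso; apply: (He u) uy; last by rewrite lt_eqF.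
  by rewrite /ball /= ger0_norm ?subr_ge0 ?ltW //; lra.
apply: analytic_near (analytic_cst 0 t0); near=> t; apply/esym.
have ty : gamma t <> y.
  have [->|tt0] := eqVneq t t0; first by move=> E; apply: Xy; rewrite -E.
  by apply: He tt0; near: t; exact: nbhsx_ballx.
by case: eqP.
Unshelve. all: by end_near.
Qed.

End AdjoinPoint.

End ZeroSets.

Theorem proposition7p7 (R : realType) (n : nat) (S : set 'rV[R]_n)
    (hS : semialgebraic S) (hAEP : AEP S) : zero_set_property S.
Proof.
have /semialgebraicP sS := hS.
move=> X HX; apply: contrapT => noF.
pose T := {F : 'rV[R]_n -> R | nash_fun S F /\ forall x, X x -> F x = 0}.
pose Z (F : T) : set 'rV[R]_n := fun x => S x /\ sval F x = 0.
have [_ XS _] := HX.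
have /choice[next Hnext] : forall F : T, exists G : T, Z G `<=` Z F /\ Z G <> Z F.
  move=> [F [nF F0]].
  have [y [Sy Fy Xy]] : exists y, [/\ S y, F y = 0 & ~ X y].
    apply: contrapT => H; apply: noF; exists F; first exact/aA_nash.
    apply/seteqP; split=> x /=; last by move=> Xx; split; [exact: XS|exact: F0].
    by move=> [Sx Fx]; apply: contrapT => Xx; apply: H; exists x.
  have [G /aA_nash nG GE] := hAEP _ (AR_closed_adjoin HX Sy) _
    ((aA_nash _ _).2 (indicator_adjoin HX Sy Xy)).
  have nH := nash_fun_sum_sqr nF nG.
  have H0 x : X x -> F x ^+ 2 + G x ^+ 2 = 0.
    move=> Xx; rewrite F0 // GE; last by left.
    by case: eqP Xx => [-> /Xy//|_ _]; rewrite expr0n addr0.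
  have [H HE] : exists H : T, sval H = fun x => F x ^+ 2 + G x ^+ 2.
    by exists (exist _ (fun x => F x ^+ 2 + G x ^+ 2) (conj nH H0)).
  rewrite /Z; exists H; rewrite HE; split=> [x [Sx]|].
    move=> /eqP; rewrite /= paddr_eq0 ?sqr_ge0 // sqrf_eq0 => /andP[/eqP Fx _].
    by split.
  move=> /(congr1 (fun A : set 'rV[R]_n => A y)) /= ZE.
  have : S y /\ F y = 0 by [].
  rewrite -ZE => -[_] /eqP; rewrite Fy GE; last by right.
  by rewrite eqxx expr0n expr1n add0r oner_eq0.
have F0 : T by exists (fun=> 0); split => //; exact: nash_fun_cst.
have [|i|N HN] := semialgebraic_noetherian sS (E := fun i => Z (iter i next F0)).
- by move=> i; apply: zero_set_arc_symmetric; have [] := svalP (iter i next F0).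
- exact: (Hnext _).1.
exact: (Hnext (iter N next F0)).2 (HN N.+1 (leqnSn N)).
Qed.
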